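(* Let $n\ge 9$ and consider the random transposition walk on $S_n$ started at the identity. Let $t>\max\big(4.14n^2+6n\log n+6(\log 2)n,\;2(\log 2)n^2+24n\log n+36n\big)$. Then for any two distinct conjugacy classes $\alpha,\beta$ of $S_n$ with $\operatorname{sgn}(\alpha)=\operatorname{sgn}(\beta)=(-1)^t$, if $\alpha>_{CL}\beta$ then $P^{*t}(\alpha)>P^{*t}(\beta)$.
   Context: The random transposition walk: $X_0=\mathrm{id}$, $X_t=X_{t-1}\tau_t$ where $\tau_t$ are i.i.d. uniform over the $\binom n2$ transpositions. $P^{*t}(\alpha)$ denotes the probability that $X_t$ equals a fixed element of the conjugacy class $\alpha$ (this is constant on classes). Classes are written $\alpha=(1^{a_1},\dots,n^{a_n})$ with $a_k$ the number of $k$-cycles. Cycle lexicographic order: for $\alpha\ne\beta$, $\alpha>_{CL}\beta$ iff $a_i>b_i$ where $i=\min\{k:a_k\ne b_k\}$. $\log$ is the natural logarithm. *)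

(* Defs.v *)
From HB Require Import structures.
From mathcomp Require Import all_boot all_order all_algebra all_fingroup.
From Stdlib Require Reals.
Set Implicit Arguments. Unset Strict Implicit. Unset Printing Implicit Defensive.
Import GRing.Theory Num.Theory.

(* P^{*t}(s): probability that the random transposition walk X_t = X_{t-1} tau_t,
   X_0 = id, tau_t uniform over the C(n,2) transpositions, equals s. *)
Fixpoint rtw_prob (n t : nat) (s : {perm 'I_n}) : rat :=
  match t with
  | 0 => ((s == 1)%g)%:R
  | t'.+1 =>
      ((\sum_(p : 'I_n * 'I_n | (p.1 < p.2)%N)
          rtw_prob t' (s * (tperm p.1 p.2)^-1)%g) / ('C(n, 2))%:R)%R
  end.

Definition ncycles (n : nat) (s : {perm 'I_n}) (k : nat) : nat :=
  #|[set O in porbits s | #|O| == k]|.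

Definition cl_gt (n : nat) (s r : {perm 'I_n}) : Prop :=
  exists i : nat, (forall k, (k < i)%N -> ncycles s k = ncycles r k) /\
                  (ncycles r i < ncycles s i)%N.

Definition time_bound (n t : nat) : Prop :=
  let N := Raxioms.INR n in
  let L := Rpower.ln N in
  let L2 := Rpower.ln (Raxioms.INR 2) in
  let R := fun k : nat => Raxioms.INR k in
  let add := Rdefinitions.Rplus in
  let mul := Rdefinitions.Rmult in
  Rdefinitions.Rlt
    (Rbasic_fun.Rmax
       (add (add (mul (Rdefinitions.Rdiv (R 414) (R 100)) (mul N N)) (mul (R 6) (mul N L)))
            (mul (R 6) (mul L2 N)))
       (add (add (mul (R 2) (mul L2 (mul N N))) (mul (R 24) (mul N L))) (mul (R 36) N)))
    (Raxioms.INR t).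

(* Main.v *)
(** Fourier inversion writes [n! * 'C(n, 2) ^ t * P^{*t}(s)] as the sum over the
    irreducible characters [chi] of [chi 1 * w chi ^ t * chi s], where [w chi] is
    the scalar by which the sum of all transpositions acts.  Twisting by the sign
    pairs [w] with [- w], so only the characters with [0 < w chi] matter.

    The length of the first row of the diagram of [chi] is the largest [#|B|] for
    which [Sym B] fixes a nonzero vector; no Specht module is needed.  Let [m] be
    the least cycle length whose multiplicities in [s] and [r] differ.  Modulo
    characters with a longer first row, [chi] is induced from the stabilizer of
    [B], whence [chi s = chi r] if the first row is longer than [n - m].  The
    two-row character [(n - m, m)] has [chi s - chi r] equal to the difference of
    the multiplicities and gives the positive leading term.

    The other characters are sorted by their first row [n - m - l] and by the
    largest size [m + l - k] of a set [Z] disjoint from [B] for which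
    [Sym B * Sym Z] fixes a nonzero vector.  An upper bound for [w chi] in terms
    of [l] and [k], compared with the dimension of the module induced from
    [Sym B * Sym Z], shows that the cell [(l, k)] contributes at most
    [64 ^- l * 4 ^- k] times the leading term.  These factors sum to less than
    [1].  For the decay of [(w chi / w) ^ t] it is enough that [4 * n ^ 2 <= t]. *)

Require Import Defs.
From HB Require Import structures.
From mathcomp Require Import all_boot all_order all_algebra all_fingroup.
From mathcomp Require Import all_field all_character.
From mathcomp Require Import zify ring.
From Stdlib Require Reals Lra.
Import Order.TTheory GRing.Theory Num.Theory.
Set Implicit Arguments. Unset Strict Implicit. Unset Printing Implicit Defensive.
Local Open Scope ring_scope.

(** The delicate point is which bound on [chi s - chi r] a cell can afford. With [g = n - 2 * m],
    twice the eigenvalue drops from its leading value [M] by at least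
    [D = 2 * l * (g + 1 - l) + (m + l) * k], and [4 * M <= t] turns this into a factor [32 ^- D]. If
    [l] and [k] are both positive, [D] is large enough for the trivial bound by twice the degree. If
    [k = 0], [D] does not grow with [m] while degrees do: the degree is compared with the leading
    one, and the values are bounded by numbers of invariant sets, hence by [2 ^ (g + 2)], both
    permutations having at most [g + 2] cycles. If [l = 0], [D] is only [m * k], and the difference
    is bounded by [m] times the difference of multiplicities, a factor that the leading term
    contains as well. *)

(** * Symmetrizers of sets of points *)

Lemma perm_extend (T : finType) (A : {set T}) (f : T -> T) :
  {in A &, injective f} -> exists y : {perm T}, {in A, y =1 f}.
Proof.
elim: {A}_.+1 {-2}A (ltnSn #|A|) => // m IHm A Am injf.
have [->|[a aA]] := set_0Vmem A; first by exists 1%g => x; rewrite inE.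
have sA x : x \in A :\ a -> x \in A by case/setD1P.
have [|y yf] := IHm (A :\ a) _ (sub_in2 sA injf).
  by move: Am; rewrite (cardsD1 a A) aA.
(* The swap corrects the image of [a] and disturbs no other point of [A]: for [x] in [A :\ a] the
   value [f x = y x] differs from [y a] and from [f a] by injectivity. *)
exists (y * tperm (y a) (f a))%g => x xA; rewrite permM.
have [->|xa] := eqVneq x a; first by rewrite tpermL.
have xA' : x \in A :\ a by rewrite !inE xa.
rewrite -(yf x xA') tpermD //; first by rewrite eq_sym (inj_eq perm_inj).
by rewrite eq_sym yf //; apply: contraNneq xa => /injf-> //.
Qed.

Lemma card_eq_preimset (T : finType) (A B : {set T}) :
  #|A| = #|B| -> exists y : {perm T}, y @^-1: B = A.
Proof.
move=> eqAB; pose f x := nth x (enum B) (index x (enum A)).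
have lt x : x \in A -> (index x (enum A) < size (enum B))%N.
  by move=> xA; rewrite -cardE -eqAB cardE index_mem mem_enum.
have injf : {in A &, injective f}.
  move=> x y xA yA; rewrite /f (set_nth_default y) ?lt // => /eqP.
  rewrite nth_uniq ?lt ?enum_uniq // => /eqP e.
  by rewrite -(nth_index x (s := enum A) (x := x)) ?mem_enum // e nth_index ?mem_enum.
have [y yf] := perm_extend injf; exists y.
apply/esym/eqP; rewrite eqEcard eqAB card_preimset ?leqnn ?andbT; last exact: perm_inj.
by apply/subsetP=> x xA; rewrite inE yf // -mem_enum mem_nth ?lt.
Qed.

Section GroupSums.

Variables (T : finType) (d : nat).
Variable rG : mx_representation algC [set: {perm T}] d.
Implicit Types (A : {set {perm T}}) (B J Z : {set T}).

(** For a group [H], [gsum H / #|H|] is the projector onto the vectors fixed by [H], so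
    [gsum H != 0] says that [H] fixes a nonzero vector. *)
Definition gsum A : 'M_d := \sum_(x in A) rG x.

(** Ordered pairs including the diagonal: twice the sum of the transpositions of [J] plus [#|J|]
    times the identity. The sum then splits along partitions of [J] and acts on [Sym J]-invariants
    as [#|J| ^ 2]. *)
Definition trsum J : 'M_d := \sum_(a in J) \sum_(b in J) rG (tperm a b).

Lemma repr_permM x y : rG (x * y)%g = rG x *m rG y.
Proof. by rewrite repr_mxM ?inE. Qed.

Lemma mul_gsum (H : {group {perm T}}) x : x \in H -> rG x *m gsum H = gsum H.
Proof.
move=> Hx; rewrite /gsum mulmx_sumr [RHS](reindex_inj (mulgI x)) /=.
by apply: eq_big => [y|y _]; [rewrite groupMl | rewrite repr_permM].
Qed.

Lemma gsum_mul (H : {group {perm T}}) x : x \in H -> gsum H *m rG x = gsum H.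
Proof.
move=> Hx; rewrite /gsum mulmx_suml [RHS](reindex_inj (mulIg x)) /=.
by apply: eq_big => [y|y _]; [rewrite groupMr | rewrite repr_permM].
Qed.

Lemma gsum_mul_sub (H : {group {perm T}}) A :
  A \subset H -> gsum H *m gsum A = #|A|%:R *: gsum H.
Proof.
move=> sAH; rewrite {2}/gsum mulmx_sumr (eq_bigr (fun=> gsum H)).
  by rewrite sumr_const scaler_nat.
by move=> x Ax; rewrite gsum_mul // (subsetP sAH).
Qed.

Lemma mul_gsum_sub (H : {group {perm T}}) A :
  A \subset H -> gsum A *m gsum H = #|A|%:R *: gsum H.
Proof.
move=> sAH; rewrite {1}/gsum mulmx_suml (eq_bigr (fun=> gsum H)).
  by rewrite sumr_const scaler_nat.
by move=> x Ax; rewrite mul_gsum // (subsetP sAH).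
Qed.

Lemma gsum_comm A (M : 'M_d) :
  (forall x, x \in A -> rG x *m M = M *m rG x) -> gsum A *m M = M *m gsum A.
Proof.
by move=> cM; rewrite /gsum mulmx_suml mulmx_sumr; apply: eq_bigr => x /cM.
Qed.

Lemma mul_repr_gsumJ A x : rG x *m gsum A = gsum (A :^ x^-1)%g *m rG x.
Proof.
rewrite /gsum mulmx_suml mulmx_sumr [RHS](reindex_inj (conjg_inj x^-1%g)) /=.
apply: eq_big => y; first by rewrite memJ_conjg.
by move=> _; rewrite -!repr_permM /conjg invgK; congr (rG _); rewrite -!mulgA mulVg mulg1.
Qed.

Lemma Sym_sub B J : B \subset J -> Sym B \subset Sym J.
Proof.
by move=> sBJ; apply/subsetP=> x; rewrite !inE => /subset_trans; apply.
Qed.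

Lemma tperm_Sym B a b : a \in B -> b \in B -> tperm a b \in Sym B.
Proof.
move=> aB bB; rewrite inE; apply: subset_trans (tperm_on a b) _.
by apply/subsetP=> x; rewrite !inE => /orP[]/eqP->.
Qed.

Lemma SymJ B x : (Sym B :^ x^-1)%g = Sym (x @^-1: B).
Proof.
apply/setP=> y; rewrite mem_conjgV !inE; apply/subsetP/subsetP => yB z.
  rewrite !inE => nz; apply: yB; rewrite inE !permM permK.
  by rewrite (inj_eq perm_inj).
rewrite inE !permM => nz; have := yB (x^-1%g z); rewrite !inE permKV; apply.
by apply: contraNneq nz => ->; rewrite permKV.
Qed.

Lemma Sym_commute B J x y : [disjoint B & J] ->
  x \in Sym B -> y \in Sym J -> commute x y.
Proof. by rewrite !inE => dBJ xB yJ; apply: perm_onC xB yJ dBJ. Qed.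

Lemma gsum_Sym_comm B J : [disjoint B & J] ->
  gsum (Sym B) *m gsum (Sym J) = gsum (Sym J) *m gsum (Sym B).
Proof.
move=> dBJ; apply: gsum_comm => x xB; symmetry; apply: gsum_comm => y yJ.
by rewrite -!repr_permM (Sym_commute dBJ xB yJ).
Qed.

(* Every permutation of [b |: B] is uniquely [y * tperm a b] with [y] in [Sym B]. *)
Lemma gsum_setU1 B b : b \notin B ->
  gsum (Sym B) *m (\sum_(a in b |: B) rG (tperm a b)) = gsum (Sym (b |: B)).
Proof.
move=> bB; rewrite mulmx_sumr {2}/gsum.
rewrite (partition_big (fun x : {perm T} => x b) [in b |: B]) /=; last first.
  by move=> x; rewrite inE => xB; rewrite perm_closed ?setU11.
apply: eq_bigr => a aB; rewrite /gsum mulmx_suml.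
rewrite [RHS](reindex_inj (mulIg (tperm a b))) /=.
have tab: tperm a b \in Sym (b |: B) by rewrite tperm_Sym ?setU11.
apply: eq_big => [x|x _]; last by rewrite repr_permM.
rewrite groupMr // permM -[X in _ && (_ == X)](tpermR a b) (inj_eq perm_inj).
apply/idP/andP => [xB | []].
  split; first exact: (subsetP (Sym_sub (subsetUr _ _))).
  by move: xB; rewrite inE => xB; rewrite (out_perm xB).
rewrite !inE => /subsetP xB /eqP xb; apply/subsetP=> z nz.
by have:= xB z nz; rewrite !inE => /orP[/eqP zb|//]; move: nz; rewrite inE zb xb eqxx.
Qed.

Lemma gsum_Sym_neq0_sub B J :
  B \subset J -> gsum (Sym J) != 0 -> gsum (Sym B) != 0.
Proof.
move=> sBJ; apply: contraNneq => B0.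
have:= mul_gsum_sub (Sym_sub sBJ); rewrite B0 mul0mx => /esym/eqP.
by rewrite scaler_eq0 pnatr_eq0 gtn_eqF ?cardG_gt0.
Qed.

Lemma gsum_Sym_card B J : #|B| = #|J| -> (gsum (Sym B) == 0) = (gsum (Sym J) == 0).
Proof.
suff imp B' J' : #|B'| = #|J'| -> gsum (Sym B') == 0 -> gsum (Sym J') == 0.
  by move=> e; apply/idP/idP; apply: imp.
move=> eqBJ /eqP B0.
have [y yB] := card_eq_preimset (esym eqBJ).
have := mul_repr_gsumJ (Sym B') y.
rewrite B0 mulmx0 SymJ yB => /esym/(congr1 (fun M => M *m rG y^-1%g)).
by rewrite mul0mx -mulmxA -repr_permM mulgV repr_mx1 mulmx1 => ->.
Qed.

Lemma gsum_Sym_le1 B : (#|B| <= 1)%N -> gsum (Sym B) = 1%:M.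
Proof.
move=> leB; rewrite /gsum (big_pred1 1%g) ?repr_mx1 // => x; rewrite inE.
by apply/idP/eqP => [xB|->]; [apply: perm_on_id xB leB | apply: perm_on1].
Qed.

(* If adding any point of [J :\: Z] to [Z] kills the symmetrizer, then the
   cross terms of [trsum J] contribute [- #|J :\: Z|] each way. *)
Lemma trsum_step (E : 'M_d) Z J : Z \subset J ->
  (forall b, b \in J :\: Z -> E *m gsum (Sym (b |: Z)) = 0) ->
  (forall x, x \in Sym Z -> rG x *m E = E *m rG x) ->
  E *m gsum (Sym Z) *m trsum J =
  ((#|Z| ^ 2)%:R - (2 * #|J :\: Z|)%:R) *: (E *m gsum (Sym Z))
  + E *m gsum (Sym Z) *m trsum (J :\: Z).
Proof.
move=> sZJ E0 cE; set F := E *m gsum (Sym Z).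
have FZ x : x \in Sym Z -> F *m rG x = F by move=> xZ; rewrite -mulmxA gsum_mul.
(* The coset sum over [b |: Z] turns [F] into [E *m gsum (Sym (b |: Z)) = 0]; its term [a = b] is
   [F] itself, so the others add up to [- F]. *)
have Fb b : b \in J :\: Z -> F *m (\sum_(a in Z) rG (tperm a b)) = - F.
  move=> bJ; have bZ: b \notin Z by case/setDP: bJ.
  apply/eqP; rewrite -addr_eq0; apply/eqP; rewrite -[RHS](E0 b bJ) -gsum_setU1 //.
  by rewrite mulmxA -/F big_setU1 //= mulmxDr tperm1 repr_mx1 mulmx1 addrC.
pose X := \sum_(b in J :\: Z) \sum_(a in Z) rG (tperm a b).
have -> : trsum J = \sum_(a in Z) \sum_(b in Z) rG (tperm a b)
    + (X + X) + trsum (J :\: Z).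
  have JE (R : nmodType) (f : T -> R) :
      \sum_(a in J) f a = \sum_(a in Z) f a + \sum_(a in J :\: Z) f a.
    by rewrite (big_setID Z) /= (setIidPr sZJ).
  rewrite /trsum JE; under eq_bigr do rewrite JE.
  under [X in _ + X = _]eq_bigr do rewrite JE.
  rewrite !big_split /= -!addrA; congr (_ + _).
  rewrite exchange_big /=; congr (_ + (_ + _)).
  by apply: eq_bigr => b _; apply: eq_bigr => a _; rewrite tpermC.
rewrite !mulmxDr; congr (_ + _); rewrite scalerBl; congr (_ + _).
  rewrite mulmx_sumr (eq_bigr (fun=> #|Z|%:R *: F)).
    by rewrite sumr_const -scaler_nat scalerA -natrM mulnn.
  move=> a aZ; rewrite mulmx_sumr (eq_bigr (fun=> F)).
    by rewrite sumr_const scaler_nat.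
  by move=> b bZ; rewrite FZ ?tperm_Sym.
rewrite mulmx_sumr (eq_bigr (fun=> - F)) //.
by rewrite sumr_const -mulrnDr addnn -mul2n scaler_nat mulNrn.
Qed.

End GroupSums.

Lemma mxtrace_idempotent (F : fieldType) d (p : 'M[F]_d) :
  p *m p = p -> \tr p = (\rank p)%:R.
Proof.
move=> pp; rewrite -{1}(mulmx_base p) mxtrace_mulC.
(* With [p = a *m b] the full-rank factorization, [p *m p = p] reads [a *m (b *m a) *m b = a *m b];
   cancelling [a] and [b] gives [b *m a = 1]. *)
suff -> : row_base p *m col_base p = 1%:M by rewrite mxtrace1.
apply: (row_full_inj (col_base_full p)); apply: (row_free_inj (row_base_free p)) => /=.
rewrite mulmx1; set a := col_base p; set b := row_base p.
by rewrite mulmxA -mulmxA [a *m b]mulmx_base.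
Qed.

(** * Schur's lemma and averaging over a finite group *)

Section Schur.

Variables (gT : finGroupType) (G : {group gT}).

Lemma schur_scalar d (rG : mx_representation algC G d) (M : 'M_d) :
  mx_irreducible rG -> (forall x, x \in G -> rG x *m M = M *m rG x) ->
  exists c, M = c%:M.
Proof.
move=> irrG cM; apply/is_scalar_mxP; apply: mx_abs_irr_cent_scalar (groupC irrG) _ _.
by apply/centgmxP=> x Gx; rewrite cM.
Qed.

Lemma schur_cfRepr d1 d2 (r1 : mx_representation algC G d1)
    (r2 : mx_representation algC G d2) (f : 'M_(d1, d2)) :
  mx_irreducible r1 -> mx_irreducible r2 ->
  (forall x, x \in G -> r1 x *m f = f *m r2 x) -> f != 0 -> cfRepr r1 = cfRepr r2.
Proof.
move=> /mx_irrP[_ irr1] /mx_irrP[_ irr2] cf nzf.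
have free_f : row_free f.
  rewrite -kermx_eq0; apply: contraTT nzf => nzk; rewrite negbK.
  have modk : mxmodule r1 (kermx f).
    by apply/mxmoduleP=> x Gx; apply/sub_kermxP; rewrite -mulmxA cf // mulmxA mulmx_ker mul0mx.
  by have /row_full_inj/(_ f 0) -> := irr1 _ modk nzk; rewrite ?mulmx_ker ?mulmx0.
have full_f : row_full f.
  have nzg : <<f>>%MS != 0 by rewrite -mxrank_eq0 mxrank_gen mxrank_eq0.
  have := irr2 <<f>>%MS _ nzg; rewrite /row_full mxrank_gen; apply.
  by apply/mxmoduleP=> x Gx; rewrite !genmxE (eqmxMr _ (genmxE f)) -cf // submxMl.
apply: cfRepr_sim; exists f => //.
by rewrite -(eqP (free_f : \rank f == d1)) (eqP (full_f : \rank f == d2)).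
Qed.

Lemma schur_average_neq d1 d2 (r1 : mx_representation algC G d1)
    (r2 : mx_representation algC G d2) (X : 'M_(d1, d2)) :
  mx_irreducible r1 -> mx_irreducible r2 -> cfRepr r1 != cfRepr r2 ->
  \sum_(x in G) r1 x^-1%g *m X *m r2 x = 0.
Proof.
move=> irr1 irr2; apply: contraNeq => nz; apply/eqP.
apply: schur_cfRepr irr1 irr2 _ nz => y Gy.
rewrite mulmx_sumr mulmx_suml (reindex_inj (mulIg y)) /=.
apply: eq_big => [x|x]; first by rewrite groupMr.
rewrite groupMr // => Gx.
rewrite invMg repr_mxM ?groupV // [r2 _]repr_mxM // !mulmxA.
by rewrite -repr_mxM ?groupV // mulgV repr_mx1 mul1mx.
Qed.

Lemma schur_average d (rG : mx_representation algC G d) (X : 'M_d) :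
  mx_irreducible rG ->
  \sum_(x in G) rG x^-1%g *m X *m rG x = (#|G|%:R * \tr X / d%:R)%:M.
Proof.
move=> irrG; have [d_gt0 _] := (mx_irrP rG).1 irrG.
set S := LHS; have [|c Sc] := @schur_scalar d rG S irrG.
  move=> y Gy; rewrite mulmx_sumr mulmx_suml (reindex_inj (mulIg y)) /=.
  apply: eq_big => [x|x]; first by rewrite groupMr.
  rewrite groupMr // => Gx.
  rewrite invMg repr_mxM ?groupV // [rG (x * y)%g]repr_mxM // !mulmxA.
  by rewrite -repr_mxM ?groupV // mulgV repr_mx1 mul1mx.
have : \tr S = #|G|%:R * \tr X.
  rewrite raddf_sum /= (eq_bigr (fun=> \tr X)) ?sumr_const ?mulr_natl // => x Gx.
  by rewrite mxtrace_mulC mulmxA -repr_mxM ?groupV // mulgV repr_mx1 mul1mx.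
rewrite Sc mxtrace_scalar => <-; congr (_%:M).
by rewrite -[c *+ d]mulr_natr mulfK // pnatr_eq0 -lt0n.
Qed.

End Schur.

(** * Eigenvalue bounds by peeling off rows *)

Section EigenvalueBound.

Variables (T : finType) (d : nat).
Variable rG : mx_representation algC [set: {perm T}] d.
Implicit Types (B J Z : {set T}).

(** Divided by [#|H|] this is an idempotent, whose trace is its rank; in characteristic zero a
    nonzero rank is a nonzero scalar. *)
Lemma gsum_trace_neq0 (H : {group {perm T}}) : gsum rG H != 0 -> \tr (gsum rG H) != 0.
Proof.
move=> nz; have nH : #|H|%:R != 0 :> algC by rewrite pnatr_eq0 -lt0n.
pose p := #|H|%:R^-1 *: gsum rG H.
have pp : p *m p = p.
  rewrite /p -scalemxAl -scalemxAr gsum_mul_sub // !scalerA.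
  by rewrite -mulrA mulVf // mulr1.
have := mxtrace_idempotent pp; rewrite linearZ /= => /(congr1 ( *%R #|H|%:R)).
rewrite mulVKf // => ->; rewrite mulf_neq0 // pnatr_eq0 mxrank_eq0.
by rewrite scaler_eq0 negb_or invr_eq0 nH.
Qed.

Lemma trsum_Sym_comm J x : x \in Sym J -> rG x *m trsum rG J = trsum rG J *m rG x.
Proof.
rewrite -groupV => xJ; rewrite /trsum mulmx_sumr mulmx_suml.
rewrite [RHS](reindex_inj (@perm_inj _ x^-1%g)) /=.
have xJE a : (x^-1%g a \in J) = (a \in J) by rewrite inE in xJ; rewrite perm_closed.
apply: eq_big => [a|a _]; first by rewrite xJE.
rewrite mulmx_sumr mulmx_suml [RHS](reindex_inj (@perm_inj _ x^-1%g)) /=.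
apply: eq_big => [b|b _]; first by rewrite xJE.
by rewrite -!repr_permM -tpermJ conjgE invgK !mulgA mulgKV.
Qed.

(** Rows are peeled off one at a time. On a shape [lambda] the operator [trsum] has eigenvalue
    [sum_i lambda_i ^ 2 - 2 (i - 1) lambda_i], at most the number of cells times the longest row; a
    maximal [Z] plays the role of that row. The factor [E] carries the symmetrizers of the rows
    already removed. *)
Lemma trsum_eigen_bound J (E : 'M_d) c z : E != 0 ->
  (forall x, x \in Sym J -> rG x *m E = E *m rG x) ->
  E *m trsum rG J = c *: E ->
  (forall Z, Z \subset J -> (z < #|Z|)%N -> E *m gsum rG (Sym Z) = 0) ->
  c <= (#|J| * z)%:R.
Proof.
move mE: #|J| => m; elim/ltn_ind: m => m IHm in J E c z mE * => nzE cE eE Ez.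
pose P Z := (Z \subset J) && (E *m gsum rG (Sym Z) != 0).
have P0 : P set0.
  by rewrite /P sub0set gsum_Sym_le1 ?mulmx1 ?cards0.
case: (arg_maxnP (fun Z => #|Z|) P0) => Z /andP[sZJ nzZ] maxZ.
have Z0 Z' : Z' \subset J -> (#|Z| < #|Z'|)%N -> E *m gsum rG (Sym Z') = 0.
  by move=> sZ' ltZ; apply/eqP; apply: contraTT ltZ => nz; rewrite -leqNgt; apply: maxZ; apply/andP.
have leZz : (#|Z| <= z)%N.
  by rewrite leqNgt; apply: contra nzZ => ltz; rewrite Ez.
have cZ : #|J| = (#|Z| + #|J :\: Z|)%N by rewrite cardsD (setIidPr sZJ) subnKC ?subset_leq_card.
(* A single point has a trivial symmetrizer, so the maximal [Z] is nonempty and the induction passes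
   to a smaller set. *)
have nzZJ : (0 < m)%N -> (0 < #|Z|)%N.
  rewrite -mE card_gt0 => /set0Pn[a aJ]; rewrite lt0n; apply: contraNneq nzE => Z_0.
  have <- : E *m gsum rG (Sym [set a]) = E.
    by rewrite gsum_Sym_le1 ?mulmx1 ?cards1.
  by rewrite Z0 ?sub1set ?cards1 ?Z_0.
have [m0|m_gt0] := posnP m.
  have J0 : J = set0 by apply/eqP; rewrite -cards_eq0 mE m0.
  move: eE; rewrite J0 /trsum big_set0 mulmx0 => /esym/eqP; rewrite scaler_eq0 (negPf nzE) orbF.
  by move/eqP->; rewrite m0.
have step := @trsum_step _ _ rG E Z J sZJ _ _.
have cEsub Z' x : Z' \subset J -> x \in Sym Z' -> rG x *m E = E *m rG x.
  by move=> sZ' xZ; apply: cE; apply: (subsetP (Sym_sub sZ')).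
have {}step := step _ (fun x => cEsub Z x sZJ).
have lt_m : (#|J :\: Z| < m)%N by rewrite -mE cZ -[ltnLHS]add0n ltn_add2r nzZJ.
have disj : [disjoint Z & J :\: Z] by rewrite -setI_eq0 setDE setICA setICr setI0.
(* By [trsum_step], [E *m gsum (Sym Z)] is an eigenvector of [trsum (J :\: Z)] with a shifted
   eigenvalue. No larger set survives, by maximality, so the induction applies with [z := #|Z|]. *)
have lec : c - ((#|Z| ^ 2)%:R - (2 * #|J :\: Z|)%:R) <= (#|J :\: Z| * #|Z|)%:R.
  apply: (IHm _ lt_m (J :\: Z) (E *m gsum rG (Sym Z)) _ _ erefl nzZ).
  - move=> x xJ; rewrite mulmxA (cEsub _ _ (subsetDl J Z) xJ) -!mulmxA; congr (_ *m _).
    symmetry; apply: gsum_comm => y yZ.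
    by rewrite -!repr_permM (Sym_commute disj yZ xJ).
  - have: E *m gsum rG (Sym Z) *m trsum rG J = c *: (E *m gsum rG (Sym Z)).
      rewrite -mulmxA (gsum_comm (M := trsum rG J)) => [|x xZ].
        by rewrite mulmxA eE -scalemxAl.
      by rewrite trsum_Sym_comm //; apply: (subsetP (Sym_sub sZJ)).
    rewrite step => [/(canRL (addKr _)) ->|b bJ]; first by rewrite [RHS]scalerBl addrC.
    apply: Z0; last by rewrite cardsU1; case/setDP: bJ => _ ->.
    by rewrite subUset sub1set sZJ andbT; case/setDP: bJ.
  - move=> Z2 sZ2 ltZ2; rewrite -mulmxA (gsum_Sym_comm _ (J := Z2)).
      by rewrite mulmxA Z0 ?mul0mx //; apply: subset_trans sZ2 (subsetDl _ _).
    by rewrite disjoint_sym; apply: disjointWl sZ2 _; rewrite disjoint_sym.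
rewrite cZ in mE; rewrite -mE.
set y := #|Z| in leZz lec *; set k := #|_| in lec *.
rewrite -(subrK ((y ^ 2)%:R - (2 * k)%:R) c).
apply: le_trans (lerD lec (lexx _)) _.
rewrite addrA lerBlDr -!natrD ler_nat; nia.
Qed.

(* [#|B|] is the length of the first row of the Young diagram of [rG]. *)
Lemma irr_depth_eigenvalue w : mx_irreducible rG -> trsum rG setT = w%:M ->
  exists B Z : {set T},
  [/\ [disjoint B & Z], (#|Z| <= #|B|)%N,
      gsum rG (Sym B) *m gsum rG (Sym Z) != 0,
      forall B', (#|B| < #|B'|)%N -> gsum rG (Sym B') = 0 &
      w + (2 * #|~: B|)%:R <= (#|B| ^ 2 + #|~: B| * #|Z|)%:R].
Proof.
case/mx_irrP=> d_gt0 _ ew.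
have gsum0 : gsum rG (Sym set0) = 1%:M by rewrite gsum_Sym_le1 ?cards0.
have nz1 : 1%:M != 0 :> 'M[algC]_d by rewrite -mxrank_eq0 mxrank1 -lt0n.
have P0 : gsum rG (Sym set0) != 0 by rewrite gsum0.
case: (arg_maxnP (P := fun B => gsum rG (Sym B) != 0) (fun B => #|B|) P0) => B nzB maxB.
have B0 B' : (#|B| < #|B'|)%N -> gsum rG (Sym B') = 0.
  by move=> lt; apply/eqP; apply: contraTT lt => nz; rewrite -leqNgt; apply: maxB.
pose P Z := (Z \subset ~: B) && (gsum rG (Sym B) *m gsum rG (Sym Z) != 0).
have P1 : P set0 by rewrite /P sub0set gsum0 mulmx1.
case: (arg_maxnP (fun Z => #|Z|) P1) => Z /andP[sZ nzZ] maxZ.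
have dBZ : [disjoint B & Z] by rewrite disjoint_sym disjoints_subset.
have dBC : [disjoint B & ~: B] by rewrite -setI_eq0 setICr.
exists B, Z; split=> //.
  by apply: maxB; apply: contraNneq nzZ => ->; rewrite mulmx0.
(* The first row is removed by [trsum_step] with [E = 1]; the rest of the diagram lives on [~: B]
   and its rows are bounded by [#|Z|]. *)
have bnd := @trsum_eigen_bound (~: B) (gsum rG (Sym B))
  (w + (2 * #|~: B|)%:R - (#|B| ^ 2)%:R) #|Z| nzB.
rewrite natrD -lerBlDl; apply: bnd.
- by move=> x xB; symmetry; apply: gsum_comm => y yB; rewrite -!repr_permM (Sym_commute dBC yB xB).
- have := @trsum_step _ _ rG 1%:M B setT (subsetT _).
  rewrite !mul1mx setTD ew mul_mx_scalar => step.
  apply: (addrI (((#|B| ^ 2)%:R - (2 * #|~: B|)%:R) *: gsum rG (Sym B))).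
  rewrite -step => [|b bB|x _]; last by rewrite mul1mx mulmx1.
    by rewrite -scalerDl; congr (_ *: _); ring.
  by rewrite mul1mx B0 // cardsU1; move: bB; rewrite inE => ->.
move=> Z' sZ'; apply: contraTeq => nz; rewrite -leqNgt; apply: maxZ.
by rewrite /P sZ'.
Qed.

End EigenvalueBound.

(** * The space fixed by the symmetric group of a set *)

Section Stabilizer.

Variable T : finType.
Implicit Types (B : {set T}) (x y g h : {perm T}).

Definition setstab B : {set {perm T}} := [set x : {perm T} | x @^-1: B == B].

Lemma setstabP B x : reflect (forall z, (x z \in B) = (z \in B)) (x \in setstab B).
Proof.
rewrite inE; apply: (iffP eqP) => [eB z | xB]; first by rewrite -{2}eB inE.
by apply/setP=> z; rewrite inE.
Qed.

Lemma setstab_group_set B : group_set (setstab B).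
Proof.
apply/group_setP; split=> [|x y /setstabP xB /setstabP yB].
  by apply/setstabP=> z; rewrite perm1.
by apply/setstabP=> z; rewrite permM yB xB.
Qed.
Canonical setstab_group B := Group (setstab_group_set B).

Lemma Sym_sub_setstab B : Sym B \subset setstab B.
Proof. by apply/subsetP=> x; rewrite inE => xB; apply/setstabP=> z; apply: perm_closed. Qed.

Lemma SymJ_setstab B h : h \in setstab B -> (Sym B :^ h = Sym B)%g.
Proof.
rewrite -groupV => hB; rewrite -[h]invgK SymJ.
by move: hB; rewrite inE => /eqP->.
Qed.

Lemma setstabE B x : {in B, forall a, x a \in B} -> x \in setstab B.
Proof.
move=> xB; rewrite inE eq_sym eqEcard card_preimset ?leqnn ?andbT; last exact: perm_inj.
by apply/subsetP=> a aB; rewrite inE xB.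
Qed.

Lemma gsum_setstab_comm B d (r : mx_representation algC [set: {perm T}] d) h :
  h \in setstab B -> r h *m gsum r (Sym B) = gsum r (Sym B) *m r h.
Proof. by move=> hB; rewrite mul_repr_gsumJ SymJ_setstab ?groupV. Qed.

(* If [g] moves some points of [B] out of [B], then it moves some [b] into [B];
   the relation [gsum (b |: B) = 0] trades [g] for the permutations
   [tperm a b * g], each of which moves fewer points of [B] out. *)
Lemma gsum_sandwich B g : exists x : {perm T} -> algC,
  forall d (r : mx_representation algC [set: {perm T}] d),
  (forall b, b \notin B -> gsum r (Sym (b |: B)) = 0) ->
  gsum r (Sym B) *m r g *m gsum r (Sym B) =
  \sum_(h in setstab B) x h *: (r h *m gsum r (Sym B)).
Proof.
move mE: #|[set a in B | g a \notin B]| => m.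
elim/ltn_ind: m g mE => m IHm g mE.
have [gB|] := boolP (g \in setstab B).
  exists (fun h => if h == g then #|Sym B|%:R else 0) => d r _.
  rewrite (bigD1 g) //= eqxx big1 => [|h /andP[_ /negPf->]]; last by rewrite scale0r.
  by rewrite addr0 -gsum_setstab_comm // -mulmxA gsum_mul_sub // -scalemxAr.
move=> ngB.
have [a0 a0B ga0] : exists2 a, a \in B & g a \notin B.
  apply/exists_inP; apply: contraR ngB => /exists_inPn gB; apply: setstabE => a aB.
  by have:= gB a aB; rewrite negbK.
have [b bB gb] : exists2 b, b \notin B & g b \in B.
  apply/exists_inP; apply: contraR ngB; rewrite -groupV => /exists_inPn gB.
  apply: setstabE => a aB; apply/negPn/negP => /gB; by rewrite permKV aB.
(* The coefficients must serve all representations at once, so that two of them can be compared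
   later; hence they are chosen for each [a] before [d] and [r] appear. *)
have /fin_all_exists[x_ xP] a : exists x : {perm T} -> algC, a \in B -> g a \notin B ->
    forall d (r : mx_representation algC [set: {perm T}] d),
    (forall b, b \notin B -> gsum r (Sym (b |: B)) = 0) ->
    gsum r (Sym B) *m r (tperm a b * g)%g *m gsum r (Sym B) =
    \sum_(h in setstab B) x h *: (r h *m gsum r (Sym B)).
  have [aB|] := boolP (a \in B); last by exists (fun=> 0).
  have [gaB|gaB] := boolP (g a \in B); first by exists (fun=> 0).
  have [|x xP] := IHm _ _ (tperm a b * g)%g erefl; last by exists x.
  rewrite -mE; apply: proper_card; apply/properP; split.
    apply/subsetP=> z; rewrite !inE permM => /andP[zB].
    have [->|za] := eqVneq z a; first by rewrite tpermL gb.
    by rewrite tpermD 1?eq_sym // ?zB //; apply: contraNneq bB => <-.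
  by exists a; rewrite !inE ?aB ?gaB // permM tpermL gb.
pose m1 := #|[set a in B | g a \in B]|.
exists (fun h => - (m1.+1%:R)^-1 * \sum_(a in B | g a \notin B) x_ a h) => d r r0.
set E := gsum r (Sym B); set S := E *m r g *m E.
have nz : m1.+1%:R != 0 :> algC by rewrite pnatr_eq0.
have EE : E = - \sum_(a in B) E *m r (tperm a b).
  apply/eqP; rewrite -addr_eq0; apply/eqP; rewrite -[RHS](r0 _ bB) -gsum_setU1 //.
  by rewrite big_setU1 //= mulmxDr tperm1 repr_mx1 mulmx1 mulmx_sumr.
(* If [g a] is in [B], then [tperm a b * g = g * tperm (g a) (g b)] and the last factor is absorbed
   by the right-hand [E]. So [S] reappears [m1] times, and collecting terms gives the factor
   [m1.+1]. *)
have SE : S = - (S *+ m1 + \sum_(a in B | g a \notin B) E *m r (tperm a b * g)%g *m E).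
  rewrite {1}/S {1}EE !mulNmx !mulmx_suml (bigID (fun a => g a \in B)) /=.
  congr (- (_ + _)); last by apply: eq_bigr => a _; rewrite repr_permM !mulmxA.
  rewrite (eq_bigr (fun=> S)) => [|a /andP[aB gaB]].
    by rewrite sumr_const /m1; congr (_ *+ _); apply: eq_card => a; rewrite !inE.
  rewrite -[E *m _ *m r g]mulmxA -repr_permM conjgC tpermJ repr_permM.
  by rewrite mulmxA -[_ *m E]mulmxA [r _ *m E]mul_gsum ?tperm_Sym.
have {}SE : S *+ m1.+1 = - \sum_(a in B | g a \notin B) E *m r (tperm a b * g)%g *m E.
  by rewrite mulrS {1}SE opprD addrAC addNr add0r.
apply: (scalerI nz); rewrite scaler_nat SE scaler_sumr -sumrN.
under eq_bigr => a /andP[aB gaB] do rewrite xP // -/E.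
under [RHS]eq_bigr => h hB do rewrite scalerA mulNr mulrN mulrA mulfV // mul1r scaleNr scaler_suml.
by rewrite !sumrN exchange_big.
Qed.

End Stabilizer.

Lemma mulmx_delta_mulmx (R : pzRingType) m n p q (A : 'M[R]_(m, n)) (B : 'M[R]_(p, q)) a b i j :
  (A *m delta_mx a b *m B) i j = A i a * B b j.
Proof.
rewrite -(mul_delta_mx (0 : 'I_1)) mulmxA -mulmxA -colE -rowE.
by rewrite mxE big_ord1 !mxE.
Qed.

Lemma mxtrace_delta_mul (R : comPzRingType) m n (B : 'M[R]_(n, m)) a b :
  \tr (delta_mx a b *m B) = B b a.
Proof.
rewrite /mxtrace (bigD1 a) //= big1 => [|i ia].
  by rewrite -[delta_mx a b]mul1mx mulmx_delta_mulmx mxE eqxx mul1r addr0.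
by rewrite -[delta_mx a b]mul1mx mulmx_delta_mulmx mxE (negPf ia) mul0r.
Qed.

(** * Orthogonality of the characters carried by fixed spaces *)

Section FixedSpaceCharacter.

Variables (T : finType) (B : {set T}).

Local Notation G := [set: {perm T}]%G.
Local Notation H := (setstab_group B).
Local Notation b := (#|Sym B|%:R : algC).

Definition first_row_le d (r : mx_representation algC [set: {perm T}] d) :=
  forall a, a \notin B -> gsum r (Sym (a |: B)) = 0.

Let bnz : b != 0.
Proof. by rewrite pnatr_eq0 -lt0n cardG_gt0. Qed.

(** The average of [X] over the stabilizer, cut down to the [Sym B]-fixed spaces of both
    representations: an intertwiner for the stabilizer. *)
Definition stab_average d1 d2 (r1 : mx_representation algC G d1) (r2 : mx_representation algC G d2) X : 'M_(d1, d2) :=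
  \sum_(h in H) gsum r1 (Sym B) *m r1 h^-1%g *m X *m r2 h *m gsum r2 (Sym B).

Section TwoReps.

Variables (d1 d2 : nat) (r1 : mx_representation algC G d1) (r2 : mx_representation algC G d2).
Local Notation E1 := (gsum r1 (Sym B)).
Local Notation E2 := (gsum r2 (Sym B)).

Let E1E1 : E1 *m E1 = b *: E1. Proof. exact: gsum_mul_sub. Qed.
Let E2E2 : E2 *m E2 = b *: E2. Proof. exact: gsum_mul_sub. Qed.

Let EQ X : E1 *m stab_average r1 r2 X = b *: stab_average r1 r2 X.
Proof.
rewrite mulmx_sumr scaler_sumr; apply: eq_bigr => h _.
by rewrite !mulmxA E1E1 !scalemxAl.
Qed.

Let QE X : stab_average r1 r2 X *m E2 = b *: stab_average r1 r2 X.
Proof.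
rewrite mulmx_suml scaler_sumr; apply: eq_bigr => h _.
by rewrite -mulmxA E2E2 scalemxAr.
Qed.

Let Qcomm X h : h \in H -> r1 h *m stab_average r1 r2 X = stab_average r1 r2 X *m r2 h.
Proof.
move=> hH; rewrite mulmx_sumr mulmx_suml (reindex_inj (mulIg h)) /=.
apply: eq_big => [k|k _]; first by rewrite groupMr.
rewrite !mulmxA (gsum_setstab_comm _ hH) -(mulmxA E1) -repr_permM.
rewrite invMg mulKVg repr_permM !mulmxA -[RHS]mulmxA -(gsum_setstab_comm _ hH).
by rewrite !mulmxA.
Qed.

Hypotheses (f1 : first_row_le r1) (f2 : first_row_le r2).

(** By [gsum_sandwich], compressing [g] between symmetrizers gives the same combination of
    stabilizer elements in both representations. An intertwiner for the stabilizer therefore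
    intertwines the compressions of the whole group. *)
Let Qsandwich X g : E1 *m r1 g *m stab_average r1 r2 X = stab_average r1 r2 X *m r2 g *m E2.
Proof.
have [x xP] := gsum_sandwich B g.
set Q := stab_average _ _ _; apply: (scalerI bnz).
have -> : b *: (E1 *m r1 g *m Q) = E1 *m r1 g *m E1 *m Q.
  by rewrite -(mulmxA _ E1) EQ scalemxAr.
have -> : b *: (Q *m r2 g *m E2) = Q *m (E2 *m r2 g *m E2).
  by rewrite !mulmxA QE !scalemxAl.
rewrite !xP // mulmx_suml mulmx_sumr; apply: eq_bigr => h hH.
rewrite -scalemxAl -scalemxAr -mulmxA EQ mulmxA -Qcomm // -mulmxA QE.
by rewrite -scalemxAr.
Qed.

(** Moving [r1 g^-1] across the stabilizer average leaves the sum of the conjugates of [E2], a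
    scalar by Schur's lemma. Hence the stabilizer average is, up to a factor, the compression of a
    [G]-intertwiner. *)
Lemma sum_conj_stab_average X : mx_irreducible r2 ->
  E1 *m (\sum_(g in G) r1 g^-1%g *m stab_average r1 r2 X *m r2 g) *m E2 =
  (#|G|%:R * \tr E2 / d2%:R * b) *: stab_average r1 r2 X.
Proof.
move=> irr2; rewrite -[RHS]scalerA -QE -[_ *: _]mul_scalar_mx.
set Q := stab_average _ _ _.
have -> : (#|G|%:R * \tr E2 / d2%:R)%:M *m (Q *m E2) =
          Q *m (#|G|%:R * \tr E2 / d2%:R)%:M *m E2.
  by rewrite mulmxA scalar_mxC.
rewrite -(schur_average _ irr2) [E1 *m _]mulmx_sumr [Q *m _]mulmx_sumr !mulmx_suml.
by apply: eq_bigr => g _; rewrite !mulmxA Qsandwich.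
Qed.

Lemma trace_pairing :
  \sum_(h in H) \tr (r1 h^-1%g *m E1) * \tr (r2 h *m E2) =
  \sum_i \sum_j stab_average r1 r2 (delta_mx i j) i j.
Proof.
under [RHS]eq_bigr => i _ do under eq_bigr => j _ do rewrite summxE.
under [RHS]eq_bigr => i _ do rewrite exchange_big.
rewrite exchange_big; apply: eq_bigr => h _.
rewrite [\tr (r1 _ *m _)]mxtrace_mulC /mxtrace mulr_suml.
apply: eq_bigr => i _; rewrite mulr_sumr; apply: eq_bigr => j _.
by rewrite -(mulmxA _ (r2 h)) mulmx_delta_mulmx.
Qed.

Lemma fixed_char_orthogonal :
  mx_irreducible r1 -> mx_irreducible r2 -> cfRepr r1 != cfRepr r2 -> E2 != 0 ->
  \sum_(h in H) \tr (r1 h^-1%g *m E1) * \tr (r2 h *m E2) = 0.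
Proof.
move=> irr1 irr2 ne12 nzE; have [d2_gt0 _] := (mx_irrP r2).1 irr2.
rewrite trace_pairing big1 // => i _; rewrite big1 // => j _.
have := sum_conj_stab_average (delta_mx i j) irr2.
rewrite schur_average_neq // mulmx0 mul0mx => /esym/eqP.
rewrite scaler_eq0 => /orP[|/eqP->]; last by rewrite mxE.
apply: contraTeq => _; rewrite !mulf_neq0 ?invr_eq0 ?pnatr_eq0 -?lt0n ?cardG_gt0 //.
exact: gsum_trace_neq0 nzE.
Qed.

End TwoReps.

(** This and [fixed_char_orthogonal] say that the fixed spaces are irreducible under the stabilizer
    and inequivalent for distinct characters. On diagrams this is the removal of the first row. *)
Lemma fixed_char_norm d (r : mx_representation algC G d) :
  mx_irreducible r -> first_row_le r -> gsum r (Sym B) != 0 ->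
  \sum_(h in H) \tr (r h^-1%g *m gsum r (Sym B)) * \tr (r h *m gsum r (Sym B)) =
  #|H|%:R * b ^+ 2.
Proof.
move=> irr fr nzE; have [d_gt0 _] := (mx_irrP r).1 irr.
set E := gsum r (Sym B); have nztr : \tr E != 0 := gsum_trace_neq0 nzE.
have EE : E *m E = b *: E by exact: gsum_mul_sub.
have nzc : #|G|%:R / d%:R * b != 0.
  by rewrite !mulf_neq0 ?invr_eq0 ?pnatr_eq0 -?lt0n ?cardG_gt0.
have trQ X : \tr (stab_average r r X) = #|H|%:R * b * \tr (X *m E).
  rewrite raddf_sum /= (eq_bigr (fun=> b * \tr (X *m E))) => [|h hH].
    by rewrite sumr_const -[LHS]mulr_natl mulrA.
  rewrite -mulmxA mxtrace_mulC -/E !mulmxA -(mulmxA (r h) E E) EE.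
  rewrite -scalemxAr gsum_setstab_comm // -/E -scalemxAl -(mulmxA E) -repr_permM.
  by rewrite mulgV repr_mx1 mulmx1 -scalemxAl linearZ /= mxtrace_mulC.
(* The average is proportional to [E]: its conjugates by [G] sum to a scalar, and compressing a
   scalar leaves a multiple of [E]. *)
have QX X : \tr E *: stab_average r r X = \tr (stab_average r r X) *: E.
  have := sum_conj_stab_average fr fr X irr.
  rewrite schur_average // mul_mx_scalar -scalemxAl EE scalerA => eqQ.
  apply: (scalerI nzc); rewrite !scalerA mulrAC [_ * b * _]mulrAC.
  rewrite -/E in eqQ; rewrite -[_ * d%:R^-1 * \tr E]mulrAC.
  rewrite -eqQ; congr (_ *: _); ring.
apply: (mulfI nztr); rewrite trace_pairing // mulr_sumr.
transitivity (#|H|%:R * b * \tr (E *m E)); last by rewrite EE linearZ /=; ring.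
rewrite [\tr (E *m E)]/mxtrace mulr_sumr; apply: eq_bigr => i _.
rewrite mulr_sumr mxE mulr_sumr; apply: eq_bigr => j _.
have /matrixP/(_ i j) := QX (delta_mx i j); rewrite [LHS]mxE [RHS]mxE => ->.
by rewrite trQ mxtrace_delta_mul; ring.
Qed.

End FixedSpaceCharacter.

Section FixedCharacterInduction.

Variables (T : finType) (B : {set T}).
Local Notation G := [set: {perm T}]%G.
Local Notation H := (setstab_group B).
Local Notation b := (#|Sym B|%:R : algC).

Let bnz : b != 0.
Proof. by rewrite pnatr_eq0 -lt0n cardG_gt0. Qed.

Let Hnz : #|H|%:R != 0 :> algC.
Proof. by rewrite pnatr_eq0 -lt0n cardG_gt0. Qed.

Fact fixed_char_subproof d (r : mx_representation algC G d) :
  is_class_fun <<H>>%g [ffun h => (b^-1 * \tr (r h *m gsum r (Sym B))) *+ (h \in H)].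
Proof.
rewrite genGid; apply: intro_class_fun => [x y Hx Hy | _ /negbTE-> //].
rewrite groupJr // conjgE !repr_permM -!mulmxA gsum_setstab_comm // mxtrace_mulC.
by rewrite -!mulmxA -repr_permM mulgV repr_mx1 mulmx1.
Qed.
(** The character of the stabilizer on the vectors fixed by [Sym B], as a trace against the
    projector [gsum (Sym B) / b]. *)
Definition fixed_char d r := Cfun 0 (@fixed_char_subproof d r).

Lemma fixed_charE d r h : h \in H ->
  @fixed_char d r h = b^-1 * \tr (r h *m gsum r (Sym B)).
Proof. by move=> hH; rewrite cfunE hH mulr1n. Qed.

Lemma fixed_char_mulr d r h y : h \in H -> y \in Sym B ->
  @fixed_char d r (h * y)%g = fixed_char r h.
Proof.
move=> hH yB; have yH := subsetP (Sym_sub_setstab B) y yB.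
by rewrite !fixed_charE ?groupM // repr_permM -mulmxA mul_gsum.
Qed.

Lemma fixed_char_conj d r h : h \in H -> (@fixed_char d r h)^* = fixed_char r h^-1%g.
Proof.
move=> hH; rewrite !fixed_charE ?groupV // rmorphM fmorphV rmorph_nat; congr (_ * _).
have chr y : \tr (r y) = cfRepr r y by rewrite cfunE inE mulr1n.
rewrite gsum_setstab_comm // mulmx_suml mulmx_sumr !(raddf_sum mxtrace) /= rmorph_sum /=.
rewrite [RHS](reindex_inj invg_inj) /=; apply: eq_big => [y|y _]; first by rewrite groupV.
by rewrite -!repr_permM !chr -char_inv ?cfRepr_char // invMg.
Qed.

(** [fixed_char r1] is invariant under translation by [Sym B], so the restriction may be averaged
    over [Sym B] as well; this inserts the symmetrizer into its trace. *)
Lemma cfdot_fixed_char_Res d1 d2 (r1 : mx_representation algC G d1)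
    (r2 : mx_representation algC G d2) :
  '[fixed_char r1, 'Res[H] (cfRepr r2)] = (#|H|%:R * b ^+ 2)^-1 *
    \sum_(h in H) \tr (r2 h^-1%g *m gsum r2 (Sym B)) * \tr (r1 h *m gsum r1 (Sym B)).
Proof.
have chr y : cfRepr r2 y = \tr (r2 y) by rewrite cfunE inE mulr1n.
rewrite cfdotE invfM -mulrA; congr (_ * _).
under eq_bigr => h hH do rewrite cfResE ?subsetT // -char_inv ?cfRepr_char // chr.
set S := LHS.
suff bS : b * S = \sum_(h in H) fixed_char r1 h * \tr (r2 h^-1%g *m gsum r2 (Sym B)).
  apply: (mulfI bnz); rewrite bS mulrA expr2 invfM mulrA mulfV // mul1r mulr_sumr.
  by apply: eq_bigr => h hH; rewrite fixed_charE // -mulrA [X in _ * X]mulrC.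
have Sy y : y \in Sym B -> S = \sum_(h in H) fixed_char r1 h * \tr (r2 (y^-1 * h^-1)%g).
  move=> yB; have yH := subsetP (Sym_sub_setstab B) y yB.
  rewrite /S (reindex_inj (mulIg y)) /=.
  apply: eq_big => [h|h]; rewrite groupMr // => hH.
  by rewrite fixed_char_mulr // invMg.
rewrite mulr_natl -sumr_const (eq_bigr _ Sy) exchange_big /=.
apply: eq_bigr => h hH; rewrite -mulr_sumr; congr (_ * _).
rewrite gsum_setstab_comm ?groupV // mulmx_suml raddf_sum /= (reindex_inj invg_inj) /=.
apply: eq_big => [y|y _]; first by rewrite groupV.
by rewrite invgK -repr_permM.
Qed.

Lemma fixed_char_sqr_norm d (r : mx_representation algC G d) :
  mx_irreducible r -> first_row_le B r -> gsum r (Sym B) != 0 ->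
  \sum_(h in H) `|fixed_char r h| ^+ 2 = #|H|%:R.
Proof.
move=> irr fr nz.
under eq_bigr => h hH do rewrite normCKC fixed_char_conj // !fixed_charE ?groupV // mulrACA.
rewrite -mulr_sumr fixed_char_norm // -invfM -expr2 mulrCA mulVf ?mulr1 //.
by rewrite expf_neq0.
Qed.

(** Frobenius reciprocity reduces the multiplicity to the pairings above. Further constituents have
    a first row longer than [#|B|]; nothing is claimed about those. *)
Lemma cfInd_fixed_char d (r : mx_representation algC G d) i :
  mx_irreducible r -> first_row_le B r -> gsum r (Sym B) != 0 -> cfRepr r = 'chi_i ->
  forall k, first_row_le B 'Chi_k -> '['Ind[G] (fixed_char r), 'chi_k] = (k == i)%:R.
Proof.
move=> irr fr nz ri k frk.
have irrk : mx_irreducible 'Chi_k by apply: socle_irr.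
rewrite -Frobenius_reciprocity -(irrRepr k) cfdot_fixed_char_Res.
have [eki|nki] := eqVneq k i; last first.
  rewrite fixed_char_orthogonal ?mulr0 // irrRepr ri.
  by rewrite (inj_eq irr_inj).
have -> : \sum_(h in H) \tr ('Chi_k h^-1%g *m gsum 'Chi_k (Sym B)) * \tr (r h *m gsum r (Sym B)) =
          \sum_(h in H) \tr (r h^-1%g *m gsum r (Sym B)) * \tr (r h *m gsum r (Sym B)).
  apply: eq_bigr => h _; congr (_ * _).
  rewrite !mulmx_sumr !raddf_sum /=; apply: eq_bigr => y _.
  have chr d' (r' : mx_representation algC G d') z : \tr (r' z) = cfRepr r' z.
    by rewrite cfunE inE mulr1n.
  by rewrite -[in LHS]repr_permM -[in RHS]repr_permM !chr irrRepr ri eki.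
by rewrite fixed_char_norm // mulVf // mulf_neq0 // expf_neq0.
Qed.

End FixedCharacterInduction.

Section FirstRow.

Variable T : finType.
Local Notation G := [set: {perm T}]%G.
Implicit Types (i k : Iirr G) (B : {set T}).

Definition first_row i := \max_(B : {set T} | gsum 'Chi_i (Sym B) != 0) #|B|.

(** Nonvanishing depends only on the size of the set, by conjugation, and passes to subsets. *)
Lemma gsum_irr_neq0 i B : (gsum 'Chi_i (Sym B) != 0) = (#|B| <= first_row i)%N.
Proof.
apply/idP/idP => [nz|]; first exact: (leq_bigmax_cond (F := fun B : {set T} => #|B|) B nz).
have /mx_irrP[d_gt0 _] : mx_irreducible 'Chi_i by apply: socle_irr.
have [|B' nzB' eB'] := @eq_bigmax_cond _ (fun B => gsum 'Chi_i (Sym B) != 0) (fun B => #|B|).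
  apply/card_gt0P; exists set0; rewrite unfold_in /= gsum_Sym_le1 ?cards0 //.
  by rewrite -mxrank_eq0 mxrank1 -lt0n.
rewrite /first_row => leB; have {}leB : (#|B| <= #|B'|)%N by rewrite -eB'.
have [B2 sB2 cB2] : exists2 B2 : {set T}, B2 \subset B' & #|B2| = #|B|.
  exists [set x in take #|B| (enum B')].
    by apply/subsetP=> x; rewrite inE => /mem_take; rewrite mem_enum.
  rewrite cardsE (card_uniqP _) ?take_uniq ?enum_uniq // size_takel //.
  by rewrite -cardE.
by rewrite -(gsum_Sym_card _ cB2); apply: gsum_Sym_neq0_sub sB2 nzB'.
Qed.

Lemma first_row_leE i B : #|B| = first_row i -> first_row_le B 'Chi_i.
Proof.
move=> eB a aB; apply/eqP; rewrite -[_ == 0]negbK gsum_irr_neq0 cardsU1 aB eB.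
by rewrite ltnn.
Qed.

(* Modulo the characters with a longer first row, ['chi_i] is induced from the
   stabilizer of [B]. *)
Lemma irr_diff_Ind i B (s r : {perm T}) : #|B| = first_row i ->
  (forall k, (first_row i < first_row k)%N -> 'chi_k s = 'chi_k r) ->
  'chi_i s - 'chi_i r =
  'Ind[G] (fixed_char B 'Chi_i) s - 'Ind[G] (fixed_char B 'Chi_i) r.
Proof.
move=> eB eqk.
set th := cfInd _ _; rewrite [th]cfun_sum_cfdot !sum_cfunE -sumrB (bigD1 i) //= big1 ?addr0.
  rewrite /th (@cfInd_fixed_char _ _ _ _ i) //; try exact: socle_irr; try exact: first_row_leE; try exact: irrRepr.
    by rewrite eqxx !cfunE !mul1r.
  by rewrite gsum_irr_neq0 eB.
move=> k nki; rewrite !cfunE -mulrBr.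
have [lek|/eqk->] := leqP (first_row k) (first_row i); last by rewrite subrr mulr0.
rewrite /th (@cfInd_fixed_char _ _ _ _ i) ?(negPf nki) ?mul0r //.
- exact: socle_irr.
- exact: first_row_leE.
- by rewrite gsum_irr_neq0 eB.
- exact: irrRepr.
move=> a aB; apply/eqP; rewrite -[_ == 0]negbK gsum_irr_neq0 cardsU1 aB eB -ltnNge.
by rewrite ltnS.
Qed.

End FirstRow.

(** * Values of characters and cycles *)

Section Agreement.

Variable T : finType.
Implicit Types (s r h k y : {perm T}) (A B J O : {set T}).

Lemma porbit_agree A s r x :
  (forall z, z \in A -> s z \in A) -> {in A, s =1 r} -> x \in A ->
  porbit s x = porbit r x.
Proof.
move=> sA eqA xA.
have iterA m : (s ^+ m)%g x \in A by elim: m => [|m IH]; rewrite ?expg0 ?perm1 // expgSr permM sA.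
have eqiter m : (s ^+ m)%g x = (r ^+ m)%g x.
  by elim: m => [|m IH]; rewrite ?expg0 // !expgSr !permM -IH eqA.
apply/setP=> z; apply/porbitP/porbitP => -[m ->]; exists m; first by rewrite eqiter.
by rewrite -eqiter.
Qed.

Lemma porbit_sub_stable A s x :
  (forall z, z \in A -> s z \in A) -> x \in A -> porbit s x \subset A.
Proof.
move=> sA xA; apply/subsetP=> _ /porbitP[m ->].
by elim: m => [|m IH]; rewrite ?expg0 ?perm1 // expgSr permM sA.
Qed.

Lemma porbitJ s y x : porbit (s ^ y) (y x) = y @: porbit s x.
Proof.
apply/setP=> z; apply/porbitP/imsetP => [[m ->]|[_ /porbitP[m ->] ->]].
  by exists ((s ^+ m)%g x); rewrite ?mem_porbit // -conjXg permJ.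
by exists m; rewrite -conjXg permJ.
Qed.

Lemma porbit_period s x a : (s ^+ a)%g x = (s ^+ (a %% #|porbit s x|))%g x.
Proof.
set p := #|_|; rewrite {1}(divn_eq a p) expgD permM mulnC expgM.
suff -> : ((s ^+ p) ^+ (a %/ p))%g x = x by [].
elim: (a %/ _)%N => [|q IH]; first by rewrite expg0 perm1.
by rewrite expgSr permM IH permX iter_porbit.
Qed.

Lemma porbit_matching s r x z : #|porbit s x| = #|porbit r z| ->
  exists f : T -> T, {in porbit s x &, injective f} /\
    forall a, f ((s ^+ a)%g x) = (r ^+ a)%g z.
Proof.
move=> eqp; pose p := #|porbit s x|.
pose f w := (r ^+ index w (traject s x p))%g z.
have idx w : w \in porbit s x -> (index w (traject s x p) < p)%N.
  by move=> wO; rewrite -{2}(size_traject s x p) index_mem -porbit_traject.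
exists f; split=> [w1 w2 w1O w2O|a].
  rewrite /f !permX -(nth_traject r (idx _ w1O)) -(nth_traject r (idx _ w2O)).
  move/eqP; rewrite nth_uniq ?size_traject ?idx //; last first.
    by rewrite /p eqp uniq_traject_porbit.
  move=> /eqP e; have nthE w : w \in porbit s x -> nth x (traject s x p) (index w (traject s x p)) = w.
    by move=> wO; rewrite nth_index // -porbit_traject.
  by rewrite -(nthE w1) // e nthE.
rewrite /f; set i := index _ _.
rewrite [RHS]porbit_period -eqp; congr ((r ^+ _)%g z).
have lt : (a %% p < p)%N by rewrite ltn_mod lt0n card_porbit_neq0.
by rewrite /i porbit_period permX -(nth_traject s lt) index_uniq ?size_traject // uniq_traject_porbit.
Qed.

Lemma preimset_perm y A : y^-1%g @: A = y @^-1: A.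
Proof.
apply/setP=> z; rewrite inE; apply/imsetP/idP => [[x xA ->]|yz]; first by rewrite permKV.
by exists (y z); rewrite ?permK.
Qed.

Lemma mem_porbitsJ s y A : (A \in porbits (s ^ y)) = (y @^-1: A \in porbits s).
Proof.
rewrite -preimset_perm; apply/imsetP/imsetP => [[x _ ->]|[x _ eA]].
  exists (y^-1%g x) => //; rewrite -{1}[x](permKV y) porbitJ -imset_comp.
  by rewrite -[RHS]imset_id; apply: eq_imset => z /=; rewrite permK.
exists (y x) => //; rewrite porbitJ -eA -imset_comp -[LHS]imset_id.
by apply: eq_imset => z /=; rewrite permKV.
Qed.

Lemma setstabCP B h : h \in setstab B -> forall z, (h z \in ~: B) = (z \in ~: B).
Proof. by move=> /setstabP hB z; rewrite !inE hB. Qed.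

Lemma setstab_conjP B s y : (s ^ y)%g \in setstab B -> forall z,
  z \in y @^-1: (~: B) -> s z \in y @^-1: (~: B).
Proof.
move=> /setstabCP sB z; rewrite inE => zB; rewrite inE.
by have := sB (y z); rewrite permJ zB.
Qed.

End Agreement.

(** * Class functions induced from the stabilizer of a set *)

Section InducedClassFunction.

Variables (T : finType) (B : {set T}) (phi : 'CF(setstab_group B)).
Local Notation G := [set: {perm T}]%G.
Local Notation H := (setstab_group B).
Local Notation J := (~: B).
Implicit Types (s r h k y : {perm T}).

Hypothesis phi_mulr : forall h k, h \in H -> k \in Sym B -> phi (h * k)%g = phi h.

(** If [h] and [k] agree on [J], then [h^-1 * k] lies in [Sym B], to which [phi] is blind; outside
    [H] both values are [0]. *)
Lemma stab_fun_agree h k : {in J, h =1 k} -> phi h = phi k.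
Proof.
have stab h' k' : {in J, h' =1 k'} -> h' \in H -> k' \in H.
  move=> eqJ hH; rewrite -groupV; apply: setstabE => a aB.
  apply: contraLR (aB) => kaB; have := setstabP _ _ hH (k'^-1%g a).
  by rewrite eqJ ?inE // permKV aB (negPf kaB).
move=> eqJ; have eqJ' : {in J, k =1 h} by move=> z zJ; rewrite eqJ.
have [hH|hH] := boolP (h \in H); last first.
  rewrite !cfun0 //; apply: contra hH; exact: stab.
have kH := stab _ _ eqJ hH.
rewrite -[k](mulKVg h) phi_mulr // inE; apply/subsetP=> z; rewrite inE permM.
apply: contraR => zB; have zJ : z \in J by rewrite inE.
rewrite -eqJ ?permKV // -(setstabCP hH) permKV //.
Qed.

Lemma stab_fun_cycle h k :
  h \in H -> k \in H -> J \in porbits h -> J \in porbits k -> phi h = phi k.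
Proof.
move=> hH kH /imsetP[x _ eJ] Jk.
have xJ : x \in J by rewrite eJ porbit_id.
have eJk : J = porbit k x.
  case/imsetP: Jk => z _ eJz; rewrite eJz; apply/esym/eqP.
  by rewrite eq_porbit_mem -eJz.
have [|f [injf fE]] := @porbit_matching _ h k x x; first by rewrite -eJ {1}eJk.
rewrite -eJ in injf.
have [y yf] := perm_extend injf.
have yJ z : z \in J -> y z \in J.
  move=> zJ; rewrite yf //; move: zJ; rewrite {1}eJ => /porbitP[a ->].
  by rewrite fE eJk mem_porbit.
have yH : y \in H.
  rewrite -groupV; apply: setstabE => a aB; apply: contraLR (aB) => yaB.
  have /yJ : y^-1%g a \in J by rewrite inE.
  by rewrite permKV inE.
rewrite -(cfunJ phi h yH); apply: stab_fun_agree => z zJ.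
have /porbitP[m ->] : z \in porbit k x by rewrite -eJk.
have memJ a : (h ^+ a)%g x \in J by rewrite eJ mem_porbit.
rewrite -{1}fE -yf // permJ -[h ((h ^+ m)%g x)]permM -expgSr yf // fE.
by rewrite expgSr permM.
Qed.

Variable m : nat.
Variables s r : {perm T}.
Hypothesis agree_s : forall x, (#|porbit s x| < m)%N -> s x = r x.
Hypothesis agree_r : forall x, (#|porbit r x| < m)%N -> s x = r x.

(** If [s ^ y] stabilizes [B], then [y @^-1: J] is a union of cycles of [s], all shorter than [m].
    There [s] and [r] coincide, so the two sums over [y] agree term by term. *)
Lemma cfInd_agree : (#|J| < m)%N -> 'Ind[G] phi s = 'Ind[G] phi r.
Proof.
move=> ltJ; rewrite !cfIndE ?subsetT //; congr (_ * _); apply: eq_bigr => y _.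
have cJ : (#|y @^-1: J| < m)%N by rewrite card_preimset //; apply: perm_inj.
have agreeJ u : (u ^ y)%g \in H -> forall z, z \in y @^-1: J -> (#|porbit u z| < m)%N.
  move=> uH z zJ; apply: leq_ltn_trans cJ; apply: subset_leq_card.
  by apply: porbit_sub_stable zJ; apply: setstab_conjP.
have conjJ : (forall z, z \in y @^-1: J -> s z = r z) -> phi (s ^ y)%g = phi (r ^ y)%g.
  move=> eqJ; apply: stab_fun_agree => z zJ.
  by rewrite -[z](permKV y) !permJ eqJ // inE permKV.
have [sH|nsH] := boolP ((s ^ y)%g \in H).
  by apply: conjJ => z /(agreeJ s sH)/agree_s.
have [rH|nrH] := boolP ((r ^ y)%g \in H).
  by apply: conjJ => z /(agreeJ r rH)/agree_r.
by rewrite !cfun0.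
Qed.

Hypothesis cardJ : #|J| = m.

(** If [J] is not a single cycle, the cycles inside it have fewer than [m] points, so both
    conjugates agree on [J]. The variable [u] lets one proof serve [s] and [r]. *)
Let agree_nonorbit u y : u = s \/ u = r -> (u ^ y)%g \in H -> J \notin porbits (u ^ y) ->
  phi (s ^ y)%g = phi (r ^ y)%g /\ (J \in porbits (s ^ y)) = (J \in porbits (r ^ y)).
Proof.
move=> usr uH Ju.
have stu z : z \in J -> (u ^ y)%g z \in J by move=> zJ; rewrite (setstabCP uH).
have small z : z \in J -> (#|porbit u (y^-1%g z)| < m)%N.
  move=> zJ; rewrite -(card_imset _ (@perm_inj _ y)) -porbitJ permKV -cardJ.
  apply: proper_card; rewrite properEneq (porbit_sub_stable stu zJ) andbT.
  by apply: contraNneq Ju => <-; apply: imset_f.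
have eqJ : {in J, (s ^ y)%g =1 (r ^ y)%g}.
  move=> z /small; rewrite -{2 3}[z](permKV y) !permJ.
  by case: usr => -> => [/agree_s|/agree_r] ->.
split; first exact: stab_fun_agree.
have eqo z : z \in J -> porbit (s ^ y) z = porbit (r ^ y) z.
  have sts w : w \in J -> (s ^ y)%g w \in J.
    by case: usr => e wJ; have := stu w wJ; rewrite e // eqJ.
  exact: porbit_agree sts eqJ.
apply/imsetP/imsetP => -[z _ eJ]; exists z => //; rewrite ?eqo // -?eqo // eJ porbit_id //.
Qed.

Lemma card_preim_eq (O : {set T}) : #|O| = #|J| -> #|[set y : {perm T} | y @^-1: J == O]| = #|H|.
Proof.
move=> eqOJ.
have [y yO] := card_eq_preimset eqOJ.
rewrite -(card_lcoset H y); apply: eq_card => k; rewrite mem_lcoset !inE -yO.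
apply/eqP/eqP => /setP e; apply/setP=> z.
  by have := e (y^-1%g z); rewrite !inE permKV permM => /negb_inj->.
by have := e (y z); rewrite !inE permM permK => ->.
Qed.

(** The sums over [y] differ only where a conjugate has [J] as a cycle. Such a [y] contributes [v],
    and each [m]-cycle is carried onto [J] by exactly [#|H|] permutations. *)
Lemma cfInd_diff v :
  (forall h, h \in H -> J \in porbits h -> phi h = v) ->
  'Ind[G] phi s - 'Ind[G] phi r =
  (#|[set O in porbits s | #|O| == m]|%:R - #|[set O in porbits r | #|O| == m]|%:R) * v.
Proof.
move=> phiv.
have orbH u y : J \in porbits (u ^ y) -> (u ^ y)%g \in H.
  case/imsetP=> x _ eJ; apply/setstabP=> z; apply: negb_inj.
  by rewrite -!in_setC eJ -!eq_porbit_mem (porbit_perm _ 1).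
have term y : phi (s ^ y)%g - (J \in porbits (s ^ y))%:R * v
            = phi (r ^ y)%g - (J \in porbits (r ^ y))%:R * v.
  have orb0 u : J \in porbits (u ^ y) -> phi (u ^ y)%g - (J \in porbits (u ^ y))%:R * v = 0.
    by move=> Ju; rewrite Ju mul1r phiv ?orbH ?subrr.
  have [Js|Js] := boolP (J \in porbits (s ^ y)); have [Jr|Jr] := boolP (J \in porbits (r ^ y)).
  - by move: (orb0 s Js) (orb0 r Jr); rewrite Js Jr => -> ->.
  - have [rH|rH] := boolP ((r ^ y)%g \in H).
      by have [_] := agree_nonorbit (or_intror erefl) rH Jr; rewrite Js (negPf Jr).
    by move: (orb0 s Js); rewrite Js => ->; rewrite mul0r subr0 cfun0.
  - have [sH|sH] := boolP ((s ^ y)%g \in H).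
      by have [_] := agree_nonorbit (or_introl erefl) sH Js; rewrite Jr (negPf Js).
    by move: (orb0 r Jr); rewrite Jr => ->; rewrite mul0r subr0 cfun0.
  rewrite !mul0r !subr0.
  have [sH|sH] := boolP ((s ^ y)%g \in H).
    by have [] := agree_nonorbit (or_introl erefl) sH Js.
  have [rH|rH] := boolP ((r ^ y)%g \in H).
    by have [] := agree_nonorbit (or_intror erefl) rH Jr.
  by rewrite !cfun0.
have count u : \sum_(y in G) (J \in porbits (u ^ y))%:R * v =
    #|H|%:R * (#|[set O in porbits u | #|O| == m]|%:R * v).
  rewrite -mulr_suml mulrA; congr (_ * _).
  rewrite -natr_sum -natrM; congr (_%:R).
  under eq_bigr => y _ do rewrite mem_porbitsJ.
  rewrite -big_mkcondr sum1dep_card.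
  rewrite -sum1_card (partition_big (fun y : {perm T} => y @^-1: J)
     [in [set O in porbits u | #|O| == m]]) /=; last first.
    move=> y; rewrite !inE /= => ->; rewrite /= -cardJ; apply/eqP.
    exact/card_preimset/perm_inj.
  rewrite -[RHS]mulnC -sum_nat_const; apply: eq_bigr => O; rewrite inE => /andP[Ou /eqP cO].
  rewrite -(card_preim_eq (O := O)) ?cO // sum1dep_card; apply: eq_card => y; rewrite !inE.
  by have [->|] := eqVneq (y @^-1: J) O; rewrite ?andbF // Ou.
have Hnz : #|H|%:R != 0 :> algC by rewrite pnatr_eq0 -lt0n cardG_gt0.
apply: (mulfI Hnz); rewrite !cfIndE ?subsetT // mulrBr !mulVKf // mulrBl mulrBr.
rewrite -!count -!sumrB; apply: eq_bigr => y _.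
have := term y; move/eqP; rewrite subr_eq addrAC => /eqP->; ring.
Qed.

End InducedClassFunction.

Section CycleValue.

Variables (T : finType) (B : {set T}) (phi : 'CF(setstab_group B)).
Local Notation H := (setstab_group B).
Local Notation J := (~: B).
Implicit Types (h k y c : {perm T}).

Hypothesis phi_mulr : forall h k, h \in H -> k \in Sym B -> phi (h * k)%g = phi h.
Hypothesis phi_norm : \sum_(h in H) `|phi h| ^+ 2 = #|H|%:R.

(* The centralizer of a [J]-cycle has order at most [#|J| * #|Sym B|], so [phi]
   takes the same value on at least [#|H| / #|J|] elements. *)
Lemma stab_fun_cycle_norm h : h \in H -> J \in porbits h -> `|phi h| ^+ 2 <= #|J|%:R.
Proof.
(* [h0] has the cycle of [h] on [J] and fixes [B] pointwise; [phi] does not distinguish them. *)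
move=> hH Jh; pose f z := if z \in J then h z else z.
have [|h0 h0f] := @perm_extend _ [set: T] f.
  move=> z w _ _; rewrite /f; case: ifPn => zJ; case: ifPn => wJ //; first exact: perm_inj.
    by move=> e; move: zJ; rewrite -(setstabCP hH) e (negPf wJ).
  by move=> e; move: wJ; rewrite -(setstabCP hH) -e (negPf zJ).
have h0J : {in J, h =1 h0} by move=> z zJ; rewrite h0f ?inE // /f zJ.
have h0S : h0 \in Sym J.
  by rewrite inE; apply/subsetP=> z; rewrite inE h0f ?inE // /f !inE; case: ifP; rewrite ?eqxx.
have SJH : Sym J \subset H.
  apply/subsetP=> k; rewrite inE => kJ; apply/setstabP=> z.
  by have := perm_closed z kJ; rewrite !inE => /negb_inj.
rewrite (stab_fun_agree phi_mulr h0J); set v := phi h0.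
have [x0 x0J eJ] : exists2 x, x \in J & J = porbit h0 x.
  case/imsetP: Jh => x _ eJ; have xJ : x \in J by rewrite eJ porbit_id.
  exists x => //; rewrite {1}eJ; apply: porbit_agree h0J xJ.
  by move=> z; rewrite (setstabCP hH).
have SB_H : Sym B \subset H := Sym_sub_setstab B.
have SBSJ y z : y \in Sym B -> z \in J -> y z = z.
  by rewrite inE => yB; rewrite inE => zJ; apply: out_perm yB zJ.
(* An element commuting with [h0] is determined on its cycle [J] by the image of [x0]; for each of
   the [#|J|] images, two choices differ by an element of [Sym B]. *)
have cent_le : (#|'C_H[h0]%g| <= #|J| * #|Sym B|)%N.
  rewrite -sum1_card (partition_big (fun k : {perm T} => k x0) [in J]) /=; last first.
    by move=> k /setIP[kH _]; rewrite (setstabCP kH).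
  rewrite -sum_nat_const; apply: leq_sum => z zJ; rewrite sum1dep_card.
  have [-> |[k0]] := set_0Vmem [set k in 'C_H[h0]%g | k x0 == z]; first by rewrite cards0.
  rewrite 2!inE => /andP[/andP[k0H k0C] /eqP k0x]; rewrite -(card_lcoset (Sym B) k0).
  apply: subset_leq_card; apply/subsetP=> k; rewrite 2!inE => /andP[/andP[kH kC] /eqP kx].
  rewrite mem_lcoset inE; apply/subsetP=> w; rewrite inE; apply: contraR => wB.
  have : w \in porbit h0 x0 by rewrite -eJ inE.
  have zO : z \in porbit h0 x0 by rewrite -eJ.
  rewrite -eq_porbit_mem in zO; rewrite -(eqP zO) => /porbitP[a ->].
  have cy : commute (k0^-1 * k)%g h0 by apply: cent1P; rewrite groupM ?groupV.
  have ca : commute (k0^-1 * k)%g (h0 ^+ a) by apply: commuteX.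
  by rewrite -permM -ca permM [(k0^-1 * k)%g z]permM -{1}k0x permK kx.
(* [phi] is constantly [v] on these products, so [#|S|] terms of its norm equal [|v| ^ 2]. *)
pose S := [set (p.1 * p.2)%g | p in setX (h0 ^: H)%g (Sym B)].
have class_SJ c : c \in (h0 ^: H)%g -> c \in Sym J.
  case/imsetP=> k kH ->; rewrite -[k]invgK -mem_conjg SymJ.
  by rewrite (_ : _ @^-1: J = J) //; apply/setP=> z; rewrite inE (setstabCP kH).
have SH : S \subset H.
  apply/subsetP=> _ /imsetP[[c y] /setXP[/= cC yB] ->].
  by rewrite groupM ?(subsetP SB_H y) ?(subsetP SJH c) ?class_SJ.
have cardS : #|S| = (#|(h0 ^: H)%g| * #|Sym B|)%N.
  rewrite card_in_imset ?cardsX // => [[c1 y1] [c2 y2]] /setXP[/= c1C y1B] /setXP[/= c2C y2B] e.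
  suff ec : c1 = c2 by move: e; rewrite ec => /mulgI->.
  have cJ c : c \in (h0 ^: H)%g -> forall z, (c z \in J) = (z \in J).
    by move=> /class_SJ; rewrite inE => cS z; apply: perm_closed.
  apply/permP=> z; have [zJ|zJ] := boolP (z \in J); last first.
    by move: (class_SJ _ c1C) (class_SJ _ c2C); rewrite !inE => S1 S2; rewrite !(out_perm _ zJ).
  by have /permP/(_ z) := e; rewrite !permM (SBSJ y1) ?(SBSJ y2) ?cJ.
have phiS k : k \in S -> phi k = v.
  case/imsetP=> [[c y] /setXP[/= cC yB] ->].
  rewrite phi_mulr ?(subsetP SJH) ?class_SJ //.
  by case/imsetP: cC => g gH ->; rewrite cfunJ.
have le1 : `|v| ^+ 2 * #|S|%:R <= #|H|%:R.
  rewrite -phi_norm (big_setID S) /= (setIidPr SH) -[leLHS]addr0 lerD //; last first.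
    by apply: sumr_ge0 => k _; rewrite exprn_ge0.
  by rewrite (eq_bigr (fun=> `|v| ^+ 2)) ?sumr_const ?mulr_natr // => k /phiS->.
have card_class : (#|(h0 ^: H)%g| * #|'C_H[h0]%g| = #|H|)%N.
  by rewrite -index_cent1 mulnC Lagrange ?subsetIl.
have posC : (0 < #|(h0 ^: H)%g| * #|Sym B|)%N.
  by rewrite muln_gt0 cardG_gt0 andbT card_gt0; apply/set0Pn; exists h0; apply: class_refl.
suff: `|v| ^+ 2 * #|S|%:R <= #|J|%:R * #|S|%:R.
  by rewrite ler_pM2r // cardS ltr0n.
rewrite (le_trans le1) // -natrM ler_nat cardS -card_class mulnCA.
by rewrite leq_mul2l cent_le orbT.
Qed.

End CycleValue.

(** * Conjugating so that the short cycles coincide *)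

Section ConjugateAgreement.

Variable T : finType.
Implicit Types (s r y : {perm T}) (D : {set T}).

Definition cycles_of_length s k := [set O in porbits s | #|O| == k].

Lemma card_cyclesJ s y k : #|cycles_of_length (s ^ y) k| = #|cycles_of_length s k|.
Proof.
rewrite -[RHS](card_imset _ (imset_inj (@perm_inj _ y))); apply: eq_card => O.
rewrite /cycles_of_length inE mem_porbitsJ; apply/andP/imsetP => [[Os cO]|[O' + ->]].
  exists (y @^-1: O); last first.
    by apply/setP=> z; rewrite -[z](permKV y) (mem_imset _ _ (@perm_inj _ y)) inE permKV.
  rewrite inE Os card_preimset //; exact: perm_inj.
rewrite inE => /andP[O's cO']; rewrite card_imset ?cO'; last exact: perm_inj.
rewrite (_ : y @^-1: _ = O') ?O's //.
by apply/setP=> z; rewrite inE mem_imset //; apply: perm_inj.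
Qed.

(** The cycles inside [D] are common to [s] and [r], so equal totals leave equally many outside. *)
Lemma orbit_outside D s r k :
  (forall z, z \in D -> s z \in D) -> {in D, s =1 r} ->
  #|cycles_of_length s k| = #|cycles_of_length r k| ->
  forall x, x \notin D -> #|porbit s x| = k ->
  exists2 z, z \notin D & #|porbit r z| = k.
Proof.
move=> sD eqD eqk x xD xk.
have rD z : z \in D -> r z \in D by move=> zD; rewrite -eqD // sD.
have eqA : cycles_of_length s k :&: powerset D = cycles_of_length r k :&: powerset D.
  apply/setP=> O; rewrite !inE; apply/andP/andP => -[/andP[Os ->] sO]; rewrite sO andbT;
    split=> //; case/imsetP: Os sO => w _ -> sO.
    have wD : w \in D by apply: (subsetP sO); rewrite porbit_id.
    by rewrite (porbit_agree sD eqD wD) imset_f.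
  have wD : w \in D by apply: (subsetP sO); rewrite porbit_id.
  by rewrite -(porbit_agree sD eqD wD) imset_f.
have : (0 < #|cycles_of_length r k :\: powerset D|)%N.
  have := cardsID (powerset D) (cycles_of_length s k).
  rewrite eqk -(cardsID (powerset D) (cycles_of_length r k)) eqA => /addnI <-.
  rewrite card_gt0; apply/set0Pn; exists (porbit s x).
  rewrite !inE xk eqxx imset_f ?andbT //.
  by apply: contra xD => /subsetP; apply; rewrite porbit_id.
rewrite card_gt0 => /set0Pn[O]; rewrite !inE => /and3P[nO /imsetP[z _ eO] /eqP cO].
exists z; last by rewrite -eO.
by apply: contra nO => zD; rewrite eO porbit_sub_stable.
Qed.

(** The region [D] of agreement grows by one short cycle of [s] at a time: a cycle of [r] of the
    same length is moved onto it by a permutation fixing [D] pointwise. *)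
Lemma conj_agree_small s r m :
  (forall k, (k < m)%N -> #|cycles_of_length s k| = #|cycles_of_length r k|) ->
  exists y, (forall x, (#|porbit s x| < m)%N -> s x = (r ^ y)%g x) /\
            (forall x, (#|porbit (r ^ y) x| < m)%N -> s x = (r ^ y)%g x).
Proof.
pose D0 := [set x | #|porbit s x| < m]%N.
suff main N D : (#|D0 :\: D| <= N)%N -> D \subset D0 -> (forall z, z \in D -> s z \in D) ->
    forall r, {in D, s =1 r} ->
    (forall k, (k < m)%N -> #|cycles_of_length s k| = #|cycles_of_length r k|) ->
    exists y, (forall x, (#|porbit s x| < m)%N -> s x = (r ^ y)%g x) /\
            (forall x, (#|porbit (r ^ y) x| < m)%N -> s x = (r ^ y)%g x).
  by apply: (main _ set0 (leqnn _)) => // [|z|z]; rewrite ?sub0set ?inE.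
elim: N D => [|N IHN] D leN sD sDD {}r eqD eqc.
  have DE : D = D0.
    by apply/eqP; rewrite eqEsubset sD -setD_eq0 -cards_eq0 -leqn0.
  exists 1%g; rewrite conjg1; split=> x.
    by move=> xs; apply: eqD; rewrite DE inE.
  (* A short cycle of [r] outside [D] would be matched by a short cycle of [s] outside [D = D0]. *)
  move=> xs; apply: (eqD); apply: contraLR (xs) => xD; rewrite -leqNgt.
  have rD z : z \in D -> r z \in D by move=> zD; rewrite -eqD // sDD.
  have eqD' : {in D, r =1 s} by move=> z zD; rewrite eqD.
  have [z zD] := orbit_outside rD eqD' (esym (eqc _ xs)) xD erefl.
  by move<-; rewrite leqNgt; apply: contra zD; rewrite DE inE.
have [D0D|[x]] := set_0Vmem (D0 :\: D).
  by apply: (IHN D) => //; rewrite D0D cards0.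
rewrite !inE => /andP[xD xm].
have [z zD zx] := orbit_outside sDD eqD (eqc _ xm) xD erefl.
have rD w : w \in D -> r w \in D by move=> wD; rewrite -eqD // sDD.
have disj (u : {perm T}) w : (forall z, z \in D -> u z \in D) -> w \notin D -> forall a, a \in porbit u w -> a \notin D.
  move=> uD wD a aw; apply: contra wD => aD.
  by apply: (subsetP (porbit_sub_stable uD aD)); rewrite porbit_sym.
have [f [injf fE]] := porbit_matching zx.
pose g w := if w \in D then w else f w.
have fx w : w \in porbit r z -> f w \in porbit s x.
  by case/porbitP=> a ->; rewrite fE mem_porbit.
have [|y yg] := @perm_extend _ (D :|: porbit r z) g.
  move=> a c; rewrite !inE /g => aA cA.
  case: ifPn aA => aD /= aA; case: ifPn cA => cD //= cA.
  - by move=> e; have := disj _ _ sDD xD _ (fx _ cA); rewrite -e aD.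
  - by move=> e; have := disj _ _ sDD xD _ (fx _ aA); rewrite e cD.
  exact: injf.
have yD w : w \in D -> y w = w by move=> wD; rewrite yg ?inE ?wD // /g wD.
have yz a : y ((r ^+ a)%g z) = (s ^+ a)%g x.
  have az := mem_porbit r a z.
  by rewrite yg ?inE ?az ?orbT // /g (negPf (disj _ _ rD zD _ az)) fE.
have [|||w wD|k km|y' yP] := IHN (D :|: porbit s x) _ _ _ (r ^ y)%g; last first.
- by exists (y * y')%g; rewrite conjgM.
- by rewrite card_cyclesJ eqc.
- move: wD; rewrite inE => /orP[wD|/porbitP[a ->]].
    by rewrite -{2}[w]yD // permJ yD ?rD // eqD.
  by rewrite -{2}yz permJ -[r _]permM -expgSr yz expgSr permM.
- move=> w; rewrite !inE => /orP[/sDD->//|xw]; apply/orP; right.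
  by rewrite -eq_porbit_mem (porbit_perm s 1) eq_porbit_mem.
- rewrite subUset sD; apply/subsetP=> w; rewrite -eq_porbit_mem inE => /eqP->.
  exact: xm.
rewrite -ltnS (leq_trans _ leN) //; apply: proper_card; apply/properP; split.
  by rewrite setDS // subsetUl.
by exists x; rewrite !inE ?xD ?xm // porbit_id orbT.
Qed.

End ConjugateAgreement.

(** * Character differences when the short cycles are equinumerous *)

Section CharacterDifference.

Variable T : finType.
Local Notation G := [set: {perm T}]%G.
Local Notation cyc := cycles_of_length.
Implicit Types (s r : {perm T}) (i : Iirr G).

Lemma exists_card_set m : (m <= #|T|)%N -> exists B : {set T}, #|B| = m.
Proof.
move=> lem; exists [set x in take m (enum T)].
by rewrite cardsE (card_uniqP _) ?take_uniq ?enum_uniq // size_takel // -cardE.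
Qed.

Lemma first_row_le_card i : (first_row i <= #|T|)%N.
Proof. by apply/bigmax_leqP=> B _; apply: max_card. Qed.

Let agree m s r :=
  (forall x, (#|porbit s x| < m)%N -> s x = r x) /\
  (forall x, (#|porbit r x| < m)%N -> s x = r x).

Lemma first_row_set i : exists2 B : {set T}, #|B| = first_row i & #|~: B| = (#|T| - first_row i)%N.
Proof.
have [B cB] := exists_card_set (first_row_le_card i).
by exists B => //; rewrite cardsCs setCK cB.
Qed.

Let fixed_mulr i (B : {set T}) h k : h \in setstab_group B -> k \in Sym B ->
  fixed_char B 'Chi_i (h * k)%g = fixed_char B 'Chi_i h.
Proof. exact: fixed_char_mulr. Qed.

(** Induction on the number of cells below the first row: characters with a longer first row already
    agree, so the difference is that of the induced character, which vanishes by [cfInd_agree]. *)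
Let irr_agree m s r i : agree m s r -> (#|T| < m + first_row i)%N -> 'chi_i s = 'chi_i r.
Proof.
move=> [ag1 ag2]; move dE: (#|T| - first_row i)%N => d.
elim/ltn_ind: d i dE => d IHd i dE ltm.
have [B cB cJ] := first_row_set i.
apply/eqP; rewrite -subr_eq0 (irr_diff_Ind cB) => [|k ltk].
  have ltJ : (#|~: B| < m)%N by rewrite cJ; have := first_row_le_card i; lia.
  by rewrite (cfInd_agree (@fixed_mulr i B) ag1 ag2 ltJ) subrr.
have := first_row_le_card k; have := first_row_le_card i => le1 le2.
by apply: (IHd _ _ k erefl); lia.
Qed.

Let irr_diff m s r i : agree m s r -> (#|T| = m + first_row i)%N ->
  `|'chi_i s - 'chi_i r| <= m%:R * `|#|cyc s m|%:R - #|cyc r m|%:R|.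
Proof.
move=> ag eqm; have [ag1 ag2] := ag; have [B cB cJ] := first_row_set i.
have {}cJ : #|~: B| = m by rewrite cJ eqm addnK.
rewrite (irr_diff_Ind cB) => [|k ltk]; last first.
  by apply: irr_agree ag _; rewrite eqm ltn_add2l.
set phi := fixed_char B 'Chi_i.
have norm2 : \sum_(h in setstab_group B) `|phi h| ^+ 2 = #|setstab_group B|%:R.
  apply: fixed_char_sqr_norm; first exact: socle_irr.
    exact: first_row_leE.
  by rewrite gsum_irr_neq0 cB.
have [v vphi vm] : exists2 v : algC,
    forall h, h \in setstab_group B -> ~: B \in porbits h -> phi h = v & `|v| <= m%:R.
  have [/exists_inP[h0 h0H Jh0]|none] := boolP [exists h0 in setstab_group B, ~: B \in porbits h0].
    exists (phi h0) => [h hH Jh|]; first exact: (stab_fun_cycle (@fixed_mulr i B)).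
    have := stab_fun_cycle_norm (@fixed_mulr i B) norm2 h0H Jh0; rewrite cJ => le_m.
    (* [|v| ^ 2 <= m] is weakened to [|v| <= m], which avoids square roots. *)
    rewrite -(ler_pXn2r (n := 2)) ?nnegrE ?normr_ge0 ?ler0n //; apply: le_trans le_m _.
    by rewrite -natrX ler_nat -mulnn; case: (m) => // k; rewrite leq_pmulr.
  exists 0 => [h hH Jh|]; last by rewrite normr0 ler0n.
  by case/exists_inP: none; exists h.
rewrite (cfInd_diff (@fixed_mulr i B) ag1 ag2 cJ vphi) normrM mulrC.
by rewrite ler_wpM2r.
Qed.

Section SameSmallCycles.

Variables (m : nat) (s r : {perm T}).
Hypothesis same_cycles : forall k, (k < m)%N -> #|cyc s k| = #|cyc r k|.

Lemma irr_eq_small_cycles i : (#|T| < m + first_row i)%N -> 'chi_i s = 'chi_i r.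
Proof.
have [y ag] := conj_agree_small same_cycles.
by move=> lt; rewrite (irr_agree ag lt) cfunJ ?inE.
Qed.

Lemma irr_diff_small_cycles i : (#|T| = m + first_row i)%N ->
  `|'chi_i s - 'chi_i r| <= m%:R * `|#|cyc s m|%:R - #|cyc r m|%:R|.
Proof.
have [y ag] := conj_agree_small same_cycles.
by move=> /(irr_diff ag); rewrite cfunJ ?inE // card_cyclesJ.
Qed.

Let one_mulr (B : {set T}) h k : h \in setstab_group B -> k \in Sym B ->
  (1 : 'CF(setstab_group B)) (h * k)%g = (1 : 'CF(setstab_group B)) h.
Proof.
by move=> hH kB; rewrite !cfun1E groupMr // (subsetP (Sym_sub_setstab B)).
Qed.

Lemma Ind1_eq_small_cycles (B : {set T}) : (#|~: B| < m)%N ->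
  'Ind[G, setstab_group B] 1 s = 'Ind[G, setstab_group B] 1 r.
Proof.
have [y [ag1 ag2]] := conj_agree_small same_cycles.
by move=> lt; rewrite (cfInd_agree (@one_mulr B) ag1 ag2 lt) cfunJ ?inE.
Qed.

Lemma Ind1_diff_small_cycles (B : {set T}) : #|~: B| = m ->
  'Ind[G, setstab_group B] 1 s - 'Ind[G, setstab_group B] 1 r = #|cyc s m|%:R - #|cyc r m|%:R.
Proof.
have [y [ag1 ag2]] := conj_agree_small same_cycles.
move=> cJ; have v1 h : h \in setstab_group B -> ~: B \in porbits h ->
    (1 : 'CF(setstab_group B)) h = 1 by move=> hH _; rewrite cfun1E hH.
have := cfInd_diff (@one_mulr B) ag1 ag2 cJ v1.
by rewrite cfunJ ?inE // card_cyclesJ mulr1.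
Qed.

End SameSmallCycles.

End CharacterDifference.

(** * Two-row characters *)

Section TwoRowCharacters.

Variable T : finType.
Local Notation G := [set: {perm T}]%G.
Local Notation n := #|T|.
Implicit Types (s r h : {perm T}) (A B C J : {set T}) (i : Iirr G).

Definition stable_sets l s : {set {set T}} := [set A : {set T} | (#|A| == l) && (s @^-1: A == A)].

Definition initial_set j : {set T} := [set x in take j (enum T)].

Lemma card_initial_set j : (j <= n)%N -> #|initial_set j| = j.
Proof.
by move=> lej; rewrite cardsE (card_uniqP _) ?take_uniq ?enum_uniq // size_takel // -cardE.
Qed.

Lemma Ind1_stable_sets B s :
  'Ind[G, setstab_group B] 1 s = #|stable_sets #|~: B| s|%:R.
Proof.
have Hnz : #|setstab_group B|%:R != 0 :> algC by rewrite pnatr_eq0 -lt0n.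
rewrite cfIndE ?subsetT //; apply: (mulfI Hnz); rewrite mulVKf // -natrM.
have mem y : (1 : 'CF(setstab_group B)) (s ^ y)%g = (y @^-1: (~: B) \in stable_sets #|~: B| s)%:R.
  rewrite cfun1E [_ @^-1: _ \in _]in_set card_preimset ?eqxx /=; last exact: perm_inj.
  congr (nat_of_bool _)%:R; apply/idP/eqP => [sB|eJ].
    apply/setP=> z; rewrite inE; have := setstabCP sB (y z); rewrite permJ.
    by rewrite !inE => ->.
  apply/setstabP=> z; apply: negb_inj; rewrite -[z](permKV y) permJ.
  by have /setP/(_ (y^-1%g z)) := eJ; rewrite !inE.
under eq_bigr => y _ do rewrite mem.
rewrite -natr_sum; congr (_%:R).
rewrite -big_mkcondr sum1dep_card -sum1_card.
rewrite (partition_big (fun y : {perm T} => y @^-1: (~: B)) [in stable_sets #|~: B| s]) /=; last first.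
  by move=> y; rewrite in_set in_setT.
rewrite mulnC -sum_nat_const; apply: eq_bigr => C Cs.
have /eqP cC : #|C| == #|~: B| by move: Cs; rewrite inE => /andP[].
rewrite -(card_preim_eq cC) sum1dep_card; apply: eq_card => y; rewrite [in LHS]in_set [in RHS]in_set.
rewrite in_set in_setT /=; have [->|] := eqVneq (y @^-1: _) C; last by rewrite andbF.
by rewrite Cs.
Qed.

(** [A] and [J] cut the points into four blocks, matched in size with those of [C] and [J]; four
    permutations, one for each block, are glued. *)
Lemma setstab_transitive J A C : #|A :&: J| = #|C :&: J| -> #|A :\: J| = #|C :\: J| ->
  exists2 h, h \in setstab (~: J) & h @: A = C.
Proof.
move=> cI cD.
have cI' : #|J :\: A| = #|J :\: C|.
  by have := cardsID A J; rewrite -(cardsID C J) [J :&: A]setIC [J :&: C]setIC cI => /addnI.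
have cD' : #|~: J :\: A| = #|~: J :\: C|.
  have := cardsID A (~: J); rewrite -(cardsID C (~: J)) ![~: J :&: _]setIC -!setDE cD.
  exact: addnI.
have [y1 e1] := card_eq_preimset cI; have [y2 e2] := card_eq_preimset cI'.
have [y3 e3] := card_eq_preimset cD; have [y4 e4] := card_eq_preimset cD'.
pose y x := if x \in J then (if x \in A then y1 else y2) else (if x \in A then y3 else y4).
pose f x := y x x.
have fE x : (f x \in J) = (x \in J) /\ (f x \in C) = (x \in A).
  have /setP/(_ x) := e1; have /setP/(_ x) := e2; have /setP/(_ x) := e3; have /setP/(_ x) := e4.
  rewrite /f /y !inE; case xJ: (x \in J); case xA: (x \in A) => /=.
  - by move=> _ _ _ /andP[-> ->].
  - by move=> _ _ /andP[/negPf-> ->].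
  - by move=> _ /andP[/negPf-> ->].
  - by move=> /andP[/negPf-> /negPf->].
have [|h hf] := @perm_extend _ [set: T] f.
  move=> x z _ _ e; have [Jx Ax] := fE x; have [Jz Az] := fE z.
  have ey : y x = y z by rewrite /y -Jx -Ax -Jz -Az e.
  by move: e; rewrite /f ey => /perm_inj.
exists h.
  by apply/setstabP=> x; rewrite hf ?inE // (fE x).1.
apply/setP=> x; rewrite -[x](permKV h) mem_imset; last exact: perm_inj.
by rewrite -(fE _).2 -hf ?inE.
Qed.

(** Cauchy-Frobenius: [l.+1] is the number of orbits of the stabilizer on [l]-sets. An orbit is
    given by the size of the intersection with [J], and the two size hypotheses let it take every
    value from [0] to [l]. *)
Lemma card_stable_sets_sum B l : (l <= #|~: B|)%N -> (l <= #|B|)%N ->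
  \sum_(h in setstab_group B) #|stable_sets l h| = (l.+1 * #|setstab_group B|)%N.
Proof.
move=> leJ leB; set J := ~: B in leJ *.
pose S := [set A : {set T} | #|A| == l].
have actS : [acts setstab_group B, on S | 'P^*].
  apply/actsP=> h _ A; rewrite !inE /= setactE card_imset //; exact: perm_inj.
rewrite -(_ : #|orbit 'P^* (setstab_group B) @: S| = l.+1); last first.
  pose C (k : 'I_l.+1) := [set x in take k (enum J)] :|: [set x in take (l - k) (enum B)].
  have CI k : C k :&: J = [set x in take k (enum J)].
    apply/setP=> x; rewrite !inE; case: (boolP (x \in B)) => xB; rewrite ?andbF ?andbT.
      by apply/esym/negP => /mem_take; rewrite mem_enum !inE xB.
    by rewrite orb_idr // => /mem_take; rewrite mem_enum (negPf xB).
  have CD k : C k :\: J = [set x in take (l - k) (enum B)].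
    apply/setP=> x; rewrite !inE negbK; case: (boolP (x \in B)) => xB /=.
      by rewrite orb_idl // => /mem_take; rewrite mem_enum !inE xB.
    by apply/esym/negP => /mem_take; rewrite mem_enum (negPf xB).
  have ctake k A : (k <= #|A|)%N -> #|[set x in take k (enum A)]| = k.
    by move=> lek; rewrite cardsE (card_uniqP _) ?take_uniq ?enum_uniq // size_takel // -cardE.
  have cCI (k : 'I_l.+1) : #|C k :&: J| = k by rewrite CI ctake //; have := ltn_ord k; lia.
  have cCD (k : 'I_l.+1) : #|C k :\: J| = (l - k)%N by rewrite CD ctake //; have := ltn_ord k; lia.
  have -> : orbit 'P^* (setstab_group B) @: S = [set orbit 'P^* (setstab_group B) (C k) | k : 'I_l.+1].
    apply/setP=> O; apply/imsetP/imsetP => [[A + ->]|[k _ ->]]; last first.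
      exists (C k) => //; rewrite inE -(cardsID J) cCI cCD.
      by have := ltn_ord k; rewrite ltnS => lek; rewrite subnKC.
    rewrite inE => /eqP cA.
    have ltk : (#|A :&: J| < l.+1)%N by rewrite ltnS -cA subset_leq_card ?subsetIl.
    exists (Ordinal ltk) => //; apply/orbit_eqP; apply/orbitP.
    have [||h hH hA] := @setstab_transitive J (C (Ordinal ltk)) A; first by rewrite cCI.
      by rewrite cCD /= -cA -(cardsID J A) addKn.
    by exists h => //; move: hH; rewrite /J setCK.
  rewrite card_imset ?card_ord // => k1 k2 /orbit_eqP/orbitP[h hH hC].
  apply: val_inj; rewrite /= -cCI -(cCI k2) -hC /= setactE.
  rewrite -[RHS](card_imset _ (@perm_inj _ h)) imsetI; last by move=> x z _ _; apply: perm_inj.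
  rewrite (_ : h @: J = J) //; apply/setP=> z; rewrite -[z](permKV h) mem_imset; last exact: perm_inj.
  by rewrite (setstabCP hH).
rewrite -Frobenius_Cauchy //; apply: eq_bigr => h _.
apply: eq_card => A; rewrite !inE /= sub1set inE; congr (_ && _) => /=.
rewrite setactE; apply/eqP/eqP => [e|e].
  rewrite -{1}e; apply/setP=> z; rewrite -[z](permKV h) mem_imset; last exact: perm_inj.
  by rewrite inE permKV.
apply/setP=> z; rewrite inE -{1}e mem_imset //; exact: perm_inj.
Qed.

(** The permutation character on [j]-sets. The stabilizer is indexed by the complement, which is the
    block [B] of the first row. *)
Definition set_char j : 'CF(G) := 'Ind[G, setstab_group (~: initial_set j)] 1.

Lemma set_charE j s : (j <= n)%N -> set_char j s = #|stable_sets j s|%:R.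
Proof. by move=> lej; rewrite /set_char Ind1_stable_sets setCK card_initial_set. Qed.

Lemma cfdot_set_char j l : (l <= j)%N -> (j + l <= n)%N ->
  '[set_char j, set_char l] = l.+1%:R.
Proof.
move=> lelj lejl; have lej : (j <= n)%N by lia.
rewrite /set_char -Frobenius_reciprocity cfdotE.
set B := ~: initial_set j.
have cJ : #|~: B| = j by rewrite setCK card_initial_set.
have cB : #|B| = (n - j)%N by rewrite cardsCs setCK card_initial_set.
have Hnz : #|setstab_group B|%:R != 0 :> algC by rewrite pnatr_eq0 -lt0n.
apply: (mulfI Hnz); rewrite mulVKf // -natrM mulnC -(card_stable_sets_sum (l := l)) ?cJ ?cB //; last lia.
rewrite natr_sum; apply: eq_bigr => h hH.
rewrite cfun1E hH mul1r cfResE ?subsetT // -/(set_char l) set_charE ?rmorph_nat //; lia.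
Qed.

Definition two_row_char j : 'CF(G) := if j is j'.+1 then set_char j - set_char j' else set_char 0.

Lemma two_row_charE j : (0 < j)%N -> two_row_char j = set_char j - set_char j.-1.
Proof. by case: j. Qed.

Lemma sum_two_row_char j : \sum_(m < j.+1) two_row_char m = set_char j.
Proof.
elim: j => [|j IH]; first by rewrite big_ord_recl big_ord0 addr0.
by rewrite big_ord_recr IH /= addrC subrK.
Qed.

Lemma set_char1 j : (j <= n)%N -> set_char j 1%g = 'C(n, j)%:R.
Proof.
move=> lej; rewrite set_charE // -card_draws; congr (_%:R); apply: eq_card => A.
rewrite !inE andb_idr // => _; apply/eqP/setP=> z; by rewrite inE perm1.
Qed.

Lemma leq_bin_pred j : (2 * j.+1 <= n)%N -> ('C(n, j) <= 'C(n, j.+1))%N.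
Proof.
move=> le; have := mul_bin_left n j => e.
rewrite -(leq_pmul2l (m := j.+1)) // e leq_mul2r; apply/orP; right; lia.
Qed.

Lemma set_char_vchar j : set_char j \in 'Z[irr G]%g.
Proof. by apply: char_vchar; apply: cfInd_char; apply: rpred1. Qed.

(** From the orbit counts, the squared norm of [set_char j.+1 - set_char j] is
    [(j + 2) - 2 (j + 1) + (j + 1) = 1], and a virtual character of norm one with nonnegative degree
    is irreducible. *)
Lemma two_row_irr j : (2 * j <= n)%N -> exists i, 'chi_i = two_row_char j.
Proof.
move=> le2.
have Zpsi : two_row_char j \in 'Z[irr G]%g.
  by case: j {le2} => [|j] /=; rewrite ?rpredB ?set_char_vchar.
have psi1 : 0 <= two_row_char j 1%g.
  case: j le2 {Zpsi} => [|j] le2 /=; first by rewrite set_char1 ?ler0n.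
  rewrite !cfunE !set_char1 ?subr_ge0 ?ler_nat ?leq_bin_pred //; lia.
have norm1 : '[two_row_char j] = 1.
  case: j le2 {Zpsi psi1} => [|j] le2 /=; first by rewrite cfdot_set_char.
  rewrite cfdotBl !cfdotBr ['[set_char j, set_char j.+1]]cfdotC !cfdot_set_char; try lia.
  by rewrite rmorph_nat -!natr1; ring.
have [[] [i e]] := vchar_norm1P Zpsi norm1; last by exists i; rewrite e scale1r.
by move: psi1; rewrite e scaleN1r cfunE oppr_ge0 lt_geF ?irr1_gt0.
Qed.

Lemma setstab_decomposition B d (r : mx_representation algC G d) h :
  h \in setstab B -> gsum r (Sym B) *m gsum r (Sym (~: B)) *m r h =
                     gsum r (Sym B) *m gsum r (Sym (~: B)).
Proof.
move=> hH; pose f x := if x \in B then h x else x.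
have [|y yf] := @perm_extend _ [set: T] f.
  move=> x z _ _; rewrite /f; case: ifPn => xB; case: ifPn => zB //; first exact: perm_inj.
    by move=> e; move: zB; rewrite -e (setstabP _ _ hH) xB.
  by move=> e; move: xB; rewrite e (setstabP _ _ hH) zB.
have yB : y \in Sym B.
  by rewrite inE; apply/subsetP=> x; rewrite inE yf ?inE // /f; case: ifP; rewrite ?eqxx.
have kJ : (y^-1 * h)%g \in Sym (~: B).
  rewrite inE; apply/subsetP=> x; rewrite inE permM inE; apply: contra => xB.
  have yxB : y^-1%g x \in B by rewrite -(perm_closed _ (_ : perm_on B y)) ?permKV //; move: yB; rewrite inE.
  by rewrite -{2}[x](permKV y) yf ?inE // /f yxB.
have dBJ : [disjoint B & ~: B] by rewrite -setI_eq0 setICr.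
rewrite -[h](mulKVg y) repr_permM mulmxA gsum_Sym_comm // -(mulmxA _ _ (r y)).
by rewrite gsum_mul // -gsum_Sym_comm // -mulmxA gsum_mul.
Qed.

(** The stabilizer is the direct product of [Sym B] and [Sym (~: B)]. *)
Lemma gsum_setstab_neq0 B d (r : mx_representation algC G d) :
  (gsum r (Sym B) *m gsum r (Sym (~: B)) != 0) = (gsum r (setstab B) != 0).
Proof.
set M := _ *m _.
have MH : M *m gsum r (setstab B) = #|setstab B|%:R *: M.
  rewrite {1}/gsum mulmx_sumr (eq_bigr (fun=> M)) => [|h hH].
    by rewrite sumr_const scaler_nat.
  by rewrite setstab_decomposition.
have SJ : Sym (~: B) \subset setstab B.
  apply/subsetP=> k; rewrite inE => kJ; apply/setstabP=> z.
  by have := perm_closed z kJ; rewrite !inE => /negb_inj.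
have HM : gsum r (setstab_group B) *m M = (#|Sym (~: B)| * #|Sym B|)%:R *: gsum r (setstab B).
  rewrite /M mulmxA gsum_mul_sub ?Sym_sub_setstab // -scalemxAl gsum_mul_sub //.
  by rewrite scalerA -natrM mulnC.
apply/idP/idP; apply: contraNneq => z0.
  have /eqP := MH; rewrite z0 mulmx0 eq_sym scaler_eq0 pnatr_eq0.
  by rewrite (gtn_eqF (cardG_gt0 (setstab_group B))).
have /eqP := HM; rewrite z0 mulmx0 eq_sym scaler_eq0 pnatr_eq0 muln_eq0.
by rewrite !(gtn_eqF (cardG_gt0 _)).
Qed.

Lemma irr_gsum_trace i (A : {set {perm T}}) : \tr (gsum 'Chi_i A) = \sum_(x in A) 'chi_i x.
Proof.
rewrite raddf_sum; apply: eq_bigr => x _.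
by rewrite -irrRepr cfunE inE mulr1n.
Qed.

Lemma cfdot_set_char_irr j i :
  ('[set_char j, 'chi_i] != 0) = (gsum 'Chi_i (setstab (~: initial_set j)) != 0).
Proof.
set B := ~: _; have Hnz : #|setstab_group B|%:R != 0 :> algC by rewrite pnatr_eq0 -lt0n.
have -> : '[set_char j, 'chi_i] = #|setstab_group B|%:R^-1 * (\tr (gsum 'Chi_i (setstab B)))^*.
  rewrite /set_char -Frobenius_reciprocity cfdotE; congr (_ * _).
  rewrite irr_gsum_trace rmorph_sum; apply: eq_bigr => h hH.
  by rewrite cfun1E hH mul1r cfResE ?subsetT.
rewrite mulf_eq0 invr_eq0 (negPf Hnz) /= conjC_eq0.
apply/idP/idP; last exact: (gsum_trace_neq0 (H := setstab_group B)).
by apply: contraNneq => ->; rewrite mxtrace0.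
Qed.

Lemma two_row_first_row i j : (2 * j <= n)%N -> 'chi_i = two_row_char j ->
  (n - j <= first_row i)%N /\ gsum 'Chi_i (setstab (~: initial_set j)) != 0.
Proof.
move=> le2 ei; set B := ~: _.
have nz : gsum 'Chi_i (setstab B) != 0.
  rewrite -cfdot_set_char_irr ei; case: j le2 {ei B} => [|j] le2 /=.
    by rewrite cfdot_set_char ?oner_neq0.
  rewrite cfdotBr !cfdot_set_char; try lia.
  by rewrite -natrB // pnatr_eq0 subSn // subnn.
split=> //; have <- : #|B| = (n - j)%N by rewrite cardsCs setCK card_initial_set //; lia.
rewrite -gsum_irr_neq0; apply: contraNneq nz => B0.
by rewrite -[_ == 0]negbK -gsum_setstab_neq0 B0 mul0mx eqxx.
Qed.

(** [set_char j] is the sum of the two-row characters up to [j], so [chi_i] is one of them, and the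
    length of its first row singles out the last. *)
Lemma irr_two_row i j : (2 * j <= n)%N -> first_row i = (n - j)%N ->
  gsum 'Chi_i (setstab (~: initial_set j)) != 0 -> 'chi_i = two_row_char j.
Proof.
move=> le2 fi; rewrite -cfdot_set_char_irr -sum_two_row_char cfdot_suml => nz.
have [m nzm] : exists m : 'I_j.+1, '[two_row_char m, 'chi_i] != 0.
  apply/existsP; apply: contraR nz => /existsPn z; rewrite big1 // => m _.
  by apply/eqP; have := z m; rewrite negbK.
have lem : (m <= j)%N by rewrite -ltnS.
have [k ek] : exists k, 'chi_k = two_row_char m by apply: two_row_irr; lia.
have eki : k = i by apply/eqP; move: nzm; rewrite -ek cfdot_irr pnatr_eq0 eqb0 negbK.
have [|lef _] := two_row_first_row _ ek; first lia.
have em : m = j :> nat by rewrite eki fi in lef; lia.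
by rewrite -em -ek eki.
Qed.

(** After the first row is removed, [trsum (~: B)] meets the symmetrizer of [~: B] and acts on it as
    the scalar [j ^ 2], so peeling is exact here. *)
Lemma two_row_eigenvalue i j w : (2 * j <= n)%N -> first_row i = (n - j)%N ->
  gsum 'Chi_i (setstab (~: initial_set j)) != 0 -> trsum 'Chi_i setT = w%:M ->
  w + (2 * j)%:R = ((n - j) ^ 2 + j ^ 2)%:R.
Proof.
move=> le2 fi; set B := ~: _; rewrite -gsum_setstab_neq0 => nz ew.
have cJ : #|~: B| = j by rewrite setCK card_initial_set //; lia.
have cB : #|B| = (n - j)%N by rewrite cardsCs setCK card_initial_set //; lia.
have := @trsum_step _ _ 'Chi_i 1%:M B setT (subsetT _).
rewrite !mul1mx setTD ew mul_mx_scalar => step.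
have {}step := step _ (fun x _ => etrans (mulmx1 _) (esym (mul1mx _))).
have kill b : b \in ~: B -> 1%:M *m gsum 'Chi_i (Sym (b |: B)) = 0.
  rewrite inE mul1mx => bB; apply/eqP; rewrite -[_ == 0]negbK gsum_irr_neq0.
  by rewrite cardsU1 bB cB fi ltnn.
have /(congr1 (fun M => M *m gsum 'Chi_i (Sym (~: B)))) := step kill.
rewrite mulmxDl -!scalemxAl -mulmxA.
have -> : trsum 'Chi_i (~: B) *m gsum 'Chi_i (Sym (~: B)) = (j ^ 2)%:R *: gsum 'Chi_i (Sym (~: B)).
  rewrite /trsum mulmx_suml (eq_bigr (fun=> j%:R *: gsum 'Chi_i (Sym (~: B)))) => [|a aJ].
    by rewrite sumr_const cJ -scaler_nat scalerA -natrM mulnn.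
  rewrite mulmx_suml (eq_bigr (fun=> gsum 'Chi_i (Sym (~: B)))) => [|c cJ'].
    by rewrite sumr_const cJ scaler_nat.
  by rewrite mul_gsum ?tperm_Sym.
rewrite -scalemxAr -scalerDl => /eqP; rewrite -subr_eq0 -scalerBl scaler_eq0 (negPf nz) orbF.
rewrite cB cJ subr_eq0 => /eqP->; rewrite !natrD; ring.
Qed.

(** A stable set is a union of cycles, so two families with different sizes inject together into the
    subsets of [porbits s]. *)
Lemma card_stable_sets_le l1 l2 s : l1 != l2 ->
  (#|stable_sets l1 s| + #|stable_sets l2 s| <= 2 ^ #|porbits s|)%N.
Proof.
move=> ne12; rewrite -cardsUI (_ : _ :&: _ = set0) ?cards0 ?addn0; last first.
  apply/setP=> A; rewrite !inE; apply/negP => /andP[/andP[/eqP-> _] /andP[e _]].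
  by rewrite e in ne12.
rewrite -card_powerset -(card_in_imset (f := fun A : {set T} => [set O in porbits s | O \subset A])).
  apply: subset_leq_card; apply/subsetP=> _ /imsetP[A _ ->]; rewrite inE.
  by apply/subsetP=> O; rewrite inE => /andP[].
have st A : A \in stable_sets l1 s :|: stable_sets l2 s -> forall z, z \in A -> s z \in A.
  by rewrite !inE => /orP[] /andP[_ /eqP e] z; rewrite -{1}e inE.
move=> A C /st sA /st sC /setP e; apply/setP=> x.
have := e (porbit s x); rewrite !inE imset_f //=.
suff eqx A' : (forall z, z \in A' -> s z \in A') -> (porbit s x \subset A') = (x \in A') by rewrite !eqx.
move=> sA'; apply/idP/idP; last exact: porbit_sub_stable.
by move/subsetP; apply; rewrite porbit_id.
Qed.

Lemma two_row_char_bound j s : (j <= n)%N -> `|two_row_char j s| <= (2 ^ #|porbits s|)%:R.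
Proof.
case: j => [|j] lej /=.
  rewrite set_charE // normr_nat ler_nat (leq_trans _ (card_stable_sets_le (l1 := 0) (l2 := 1) s _)) //.
  exact: leq_addr.
rewrite !cfunE !set_charE //; last lia.
have nej : j != j.+1 by rewrite neq_ltn ltnSn.
have := card_stable_sets_le s nej.
set a := #|stable_sets j s|; set b := #|_| => leab.
apply: le_trans (ler_normB _ _) _; rewrite !normr_nat -natrD ler_nat addnC //.
Qed.

End TwoRowCharacters.

(** * Degrees of characters with a vector fixed by two disjoint blocks *)

Section SymmetrizerPairs.

Variable T : finType.
Local Notation G := [set: {perm T}]%G.
Local Notation n := #|T|.
Implicit Types (B Z : {set T}) (i : Iirr G).

Lemma disjoint_pair_transitive B Z B' Z' : [disjoint B & Z] -> [disjoint B' & Z'] ->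
  #|B| = #|B'| -> #|Z| = #|Z'| -> exists y : {perm T}, y @^-1: B = B' /\ y @^-1: Z = Z'.
Proof.
move=> dBZ dBZ' cB cZ.
have [y1 e1] := card_eq_preimset (esym cB); have [y2 e2] := card_eq_preimset (esym cZ).
pose f x := if x \in B' then y1 x else y2 x.
have fB x : x \in B' -> f x \in B by move=> xB; rewrite /f xB; move: xB; rewrite -e1 inE.
have fZ x : x \in Z' -> f x \in Z.
  move=> xZ; rewrite /f ifN; first by move: xZ; rewrite -e2 inE.
  by apply: contraTN xZ => xB; rewrite (disjointFr dBZ' xB).
have [|y yf] := @perm_extend _ (B' :|: Z') f.
  move=> x z; rewrite !inE => xB zB.
  have [xB'|xB'] := boolP (x \in B'); have [zB'|zB'] := boolP (z \in B').
  - by rewrite /f xB' zB' => /perm_inj.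
  - by move=> e; have := disjointFr dBZ (fB _ xB'); rewrite e fZ //; move: zB; rewrite (negPf zB').
  - by move=> e; have := disjointFr dBZ (fB _ zB'); rewrite -e fZ //; move: xB; rewrite (negPf xB').
  by rewrite /f (negPf xB') (negPf zB') => /perm_inj.
exists y; split; apply/esym/eqP; rewrite eqEcard card_preimset ?cB ?cZ ?leqnn ?andbT;
  try exact: perm_inj; apply/subsetP=> x xA; rewrite inE yf ?inE ?xA ?orbT //.
- exact: fB.
- exact: fZ.
Qed.

Definition gsum_pair d (r : mx_representation algC G d) B Z := gsum r (Sym B) *m gsum r (Sym Z).

Lemma gsum_pair_neq0_card d (r : mx_representation algC G d) B Z B' Z' :
  [disjoint B & Z] -> [disjoint B' & Z'] -> #|B| = #|B'| -> #|Z| = #|Z'| ->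
  gsum_pair r B Z != 0 -> gsum_pair r B' Z' != 0.
Proof.
move=> dBZ dBZ' cB cZ; apply: contraNneq => M0.
have [y [<- <-]] := disjoint_pair_transitive dBZ' dBZ (esym cB) (esym cZ).
rewrite /gsum_pair -!SymJ.
have := mul_repr_gsumJ r (Sym Z') y => eZ; have := mul_repr_gsumJ r (Sym B') y => eB.
have e : gsum_pair r (y @^-1: B') (y @^-1: Z') *m r y = r y *m gsum_pair r B' Z'.
  by rewrite /gsum_pair -!SymJ -mulmxA -eZ mulmxA -eB mulmxA.
rewrite M0 mulmx0 in e; move/(congr1 (fun M => M *m r y^-1%g)): e.
by rewrite mul0mx -mulmxA -repr_permM mulgV repr_mx1 mulmx1 /gsum_pair -!SymJ => ->.
Qed.

Lemma gsum_pair_trace i B Z : [disjoint B & Z] ->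
  \tr (gsum_pair 'Chi_i B Z) = (#|B|`! * #|Z|`! * \rank (gsum_pair 'Chi_i B Z))%:R.
Proof.
move=> dBZ; set M := gsum_pair _ _ _; set c : algC := (#|B|`! * #|Z|`!)%:R.
have nz : c != 0 by rewrite pnatr_eq0 muln_eq0 negb_or -!lt0n !fact_gt0.
have MM : M *m M = c *: M.
  rewrite /M /gsum_pair mulmxA -(mulmxA _ _ (gsum _ (Sym B))) -gsum_Sym_comm // !mulmxA.
  rewrite gsum_mul_sub // -!mulmxA gsum_mul_sub // -!scalemxAl -scalemxAr scalerA.
  by rewrite !card_Sym -natrM.
have /mxtrace_idempotent : (c^-1 *: M) *m (c^-1 *: M) = c^-1 *: M.
  by rewrite -scalemxAl -scalemxAr MM !scalerA mulfVK.
rewrite mxrank_scale_nz ?invr_eq0 // linearZ /= => /(congr1 ( *%R c)).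
by rewrite mulVKf // => ->; rewrite -natrM.
Qed.

(** The regular character is evaluated on the products [x * y]; as the blocks are disjoint, only
    [x = y = 1] gives the identity. *)
Lemma sum_gsum_pair_trace B Z : [disjoint B & Z] ->
  \sum_i 'chi_i 1%g * \tr (gsum_pair 'Chi_i B Z) = (n`!)%:R.
Proof.
move=> dBZ.
have -> : n`! = #|G| by rewrite -(cardsT T) -card_Sym; apply: eq_card => x; rewrite [RHS]inE; apply/idP; rewrite inE; apply/subsetP=> z; rewrite inE.
transitivity (\sum_(x in Sym B) \sum_(y in Sym Z) cfReg G (x * y)%g).
  under [RHS]eq_bigr => x _ do under eq_bigr => y _ do rewrite cfReg_sum sum_cfunE.
  under [RHS]eq_bigr => x _ do rewrite exchange_big.
  rewrite exchange_big; apply: eq_bigr => i _.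
  rewrite /gsum_pair /gsum mulmx_suml raddf_sum mulr_sumr; apply: eq_bigr => x _.
  rewrite mulmx_sumr raddf_sum mulr_sumr; apply: eq_bigr => y _.
  by rewrite -repr_permM [RHS]cfunE; congr (_ * _); rewrite -irrRepr cfunE inE mulr1n.
rewrite (bigD1 1%g) ?group1 //= (bigD1 1%g) ?group1 //= mulg1 cfRegE eqxx mulr1n.
rewrite !big1 ?addr0 // => [x /andP[xB nx]|y /andP[_ ny]]; last first.
  by rewrite mul1g cfRegE (negPf ny).
apply: big1 => y yZ; rewrite cfRegE; case: eqP => // xy.
case/negP: nx; apply/eqP/permP=> z; rewrite perm1.
have ex : x = y^-1%g by apply/eqP; rewrite eq_mulgV1 invgK xy.
have [zB|zB] := boolP (z \in B); last by move: xB; rewrite inE => xB; rewrite (out_perm xB).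
by move: yZ; rewrite ex -groupV inE => yZ; rewrite (out_perm yZ) // (disjointFr dBZ zB).
Qed.

Lemma fact_le_expn j z : (z <= j)%N -> (j`! <= z`! * j ^ (j - z))%N.
Proof.
elim: j => [|j IH]; first by rewrite leqn0 => /eqP->.
rewrite leq_eqVlt => /predU1P[->|]; first by rewrite subnn muln1.
rewrite ltnS => lezj; rewrite subSn // factS expnS mulnCA leq_mul2l /=.
apply: leq_trans (IH lezj) _; rewrite leq_mul2l; apply/orP; right.
by case: (j - z)%N => // k; rewrite leq_exp2r.
Qed.

(** [n! / ((n - j)! z!)] is the dimension of the module induced from [Sym B * Sym Z], in which every
    [chi_i] with [P i] occurs; [j! / z!] is then bounded by [j ^ (j - z)]. *)
Lemma sum_degree_gsum_pair (P : pred (Iirr G)) j z B Z :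
  #|B| = (n - j)%N -> #|Z| = z -> (z <= j)%N -> (j <= n)%N -> [disjoint B & Z] ->
  (forall i, P i -> gsum_pair 'Chi_i B Z != 0) ->
  \sum_(i | P i) 'chi_i 1%g <= ('C(n, j) * j ^ (j - z))%:R.
Proof.
move=> cB cZ lezj lejn dBZ PM.
have pos : 0 < ((n - j)`! * z`!)%:R :> algC by rewrite ltr0n muln_gt0 !fact_gt0.
have le1 : (\sum_(i | P i) 'chi_i 1%g) * ((n - j)`! * z`!)%:R <= (n`!)%:R.
  rewrite -(sum_gsum_pair_trace dBZ) mulr_suml [leRHS](bigID P) /= -[leLHS]addr0.
  apply: lerD; last first.
    by apply: sumr_ge0 => i _; rewrite gsum_pair_trace // mulr_ge0 ?ler0n ?ltW ?irr1_gt0.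
  apply: ler_sum => i /PM nz; rewrite gsum_pair_trace // cB cZ.
  apply: ler_wpM2l; first by rewrite ltW ?irr1_gt0.
  rewrite ler_nat leq_pmulr //.
  by rewrite lt0n mxrank_eq0.
rewrite -(ler_pM2r pos) (le_trans le1) // -natrM ler_nat.
rewrite -(bin_fact lejn) -mulnA leq_mul2l; apply/orP; right.
rewrite mulnC [X in (_ <= X)%N]mulnCA leq_mul2l mulnC fact_le_expn ?orbT //.
Qed.

End SymmetrizerPairs.

(** * Fourier expansion of the walk *)

Section Fourier.

Variable n : nat.
Local Notation G := [set: {perm 'I_n}]%G.
Implicit Types (s r : {perm 'I_n}) (i : Iirr G).

Definition transp_eigenvalue i : algC :=
  (\sum_(p : 'I_n * 'I_n | (p.1 < p.2)%N) 'chi_i (tperm p.1 p.2)) / 'chi_i 1%g.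

Lemma trsum_transpositions d (r : mx_representation algC G d) :
  trsum r setT = (\sum_(p : 'I_n * 'I_n | (p.1 < p.2)%N) r (tperm p.1 p.2)) *+ 2 + n%:R%:M.
Proof.
pose f (p : 'I_n * 'I_n) := r (tperm p.1 p.2).
have -> : trsum r setT = \sum_p f p.
  rewrite /trsum -(pair_bigA _ (fun a b => r (tperm a b))) /=.
  by apply: eq_big => [a|a _]; rewrite ?inE //; apply: eq_bigl => b; rewrite inE.
rewrite (bigID (fun p : 'I_n * 'I_n => p.1 < p.2)%N) /= mulr2n -addrA; congr (_ + _).
rewrite (bigID (fun p : 'I_n * 'I_n => p.2 < p.1)%N) /=; congr (_ + _).
  pose sw (p : 'I_n * 'I_n) := (p.2, p.1).
  have swK : involutive sw by case.
  rewrite (reindex_inj (inv_inj swK)) /=; apply: eq_big => [p|p _].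
    by rewrite /= -leqNgt andb_idl // => /ltnW.
  by rewrite /f tpermC.
rewrite (eq_bigl (fun p : 'I_n * 'I_n => p.1 == p.2)) => [|[a b]]; last first.
  by rewrite /= -!leqNgt -eqn_leq eq_sym.
rewrite -(pair_big_dep xpredT (fun a b => a == b) (fun a b => r (tperm a b))) /=.
rewrite (eq_bigr (fun=> 1%:M)) => [|a _].
  by rewrite sumr_const card_ord raddfMn.
by rewrite (big_pred1 a) ?tperm1 ?repr_mx1 // => b; rewrite eq_sym.
Qed.

Lemma transpositions_scalar i :
  \sum_(p : 'I_n * 'I_n | (p.1 < p.2)%N) 'Chi_i (tperm p.1 p.2) = (transp_eigenvalue i)%:M.
Proof.
have irr : mx_irreducible 'Chi_i by apply: socle_irr.
set S := LHS; have [|c Sc] := @schur_scalar _ _ _ 'Chi_i S irr.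
  move=> x _; have : 'Chi_i x *m trsum 'Chi_i setT = trsum 'Chi_i setT *m 'Chi_i x.
    by apply: trsum_Sym_comm; rewrite inE; apply/subsetP=> z; rewrite inE.
  rewrite trsum_transpositions -/S mulmxDr mulmxDl scalar_mxC => /addIr.
  rewrite -scaler_nat -scalemxAr -scalemxAl => /scalerI; apply.
  by rewrite pnatr_eq0.
have chr x : \tr ('Chi_i x) = 'chi_i x by rewrite -irrRepr cfunE inE mulr1n.
rewrite Sc; congr (_%:M); rewrite /transp_eigenvalue.
have -> : \sum_(p : 'I_n * 'I_n | (p.1 < p.2)%N) 'chi_i (tperm p.1 p.2) = \tr S.
  by rewrite raddf_sum; apply: eq_bigr => p _; rewrite -chr.
rewrite Sc mxtrace_scalar -chr repr_mx1 mxtrace1 -[c *+ _]mulr_natr mulfK // pnatr_eq0 -lt0n.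
by case/mx_irrP: irr.
Qed.

Lemma trsum_eigenvalue i : trsum 'Chi_i setT = (transp_eigenvalue i *+ 2 + n%:R)%:M.
Proof. by rewrite trsum_transpositions transpositions_scalar !mulr2n !raddfD. Qed.

Lemma irr_mul_transpositions i s :
  \sum_(p : 'I_n * 'I_n | (p.1 < p.2)%N) 'chi_i (s * (tperm p.1 p.2)^-1)%g =
  transp_eigenvalue i * 'chi_i s.
Proof.
have chr x : \tr ('Chi_i x) = 'chi_i x by rewrite -irrRepr cfunE inE mulr1n.
rewrite -chr -linearZ /= -mul_mx_scalar -transpositions_scalar mulmx_sumr raddf_sum.
by apply: eq_bigr => p _; rewrite tpermV -chr repr_permM.
Qed.

(** The regular character gives the case [t = 0], and a step of the walk multiplies each [chi_i] by
    its eigenvalue. *)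
Lemma rtw_prob_fourier t s : (1 < n)%N ->
  ratr (rtw_prob t s) * (n`!)%:R * 'C(n, 2)%:R ^+ t =
  \sum_i 'chi_i 1%g * transp_eigenvalue i ^+ t * 'chi_i s :> algC.
Proof.
move=> n_gt1; have nzC : 'C(n, 2)%:R != 0 :> algC by rewrite pnatr_eq0 -lt0n bin_gt0.
elim: t s => [|t IH] s.
  under eq_bigr do rewrite mulr1.
  have -> : \sum_i 'chi[G]_i 1%g * 'chi_i s = cfReg G s.
    by rewrite cfReg_sum sum_cfunE; apply: eq_bigr => i _; rewrite cfunE.
  rewrite cfRegE /= mulr1 ratr_nat; have -> : #|G| = n`!.
    rewrite -[n in n`!]card_ord -cardsT -(card_Sym [set: 'I_n]); apply: eq_card => x.
    by rewrite inE; apply/esym/idP; rewrite inE; apply/subsetP=> z; rewrite inE.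
  by case: eqP => _; rewrite ?mul1r ?mul0r.
transitivity (\sum_(p : 'I_n * 'I_n | (p.1 < p.2)%N)
    (ratr (rtw_prob t (s * (tperm p.1 p.2)^-1)%g) * (n`!)%:R * 'C(n, 2)%:R ^+ t : algC)).
  by rewrite /= rmorphM fmorphV rmorph_nat rmorph_sum exprSr -!mulr_suml; field.
under eq_bigr do rewrite IH.
rewrite exchange_big; apply: eq_bigr => i _.
by rewrite -mulr_sumr irr_mul_transpositions exprSr !mulrA.
Qed.

Lemma transp_eigenvalue_real i : transp_eigenvalue i \is Num.real.
Proof.
rewrite rpredM ?rpredV ?(ger0_real (ltW (irr1_gt0 i))) //.
apply: rpred_sum => p _; apply/CrealP.
by rewrite -char_inv ?irr_char // tpermV.
Qed.

Lemma sign_repr_subproof : mx_repr G (fun s : {perm 'I_n} => ((-1) ^+ odd_perm s)%:M : 'M[algC]_1).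
Proof.
split=> [|x y _ _]; first by rewrite odd_perm1.
by rewrite odd_permM signr_addb scalar_mxM.
Qed.

Definition sign_char := cfRepr (MxRepresentation sign_repr_subproof).

Lemma sign_charE s : sign_char s = (-1) ^+ odd_perm s.
Proof. by rewrite cfunE inE mulr1n mxtrace_scalar. Qed.

Lemma sign_char_mulE (phi : 'CF(G)) s : (sign_char * phi) s = (-1) ^+ odd_perm s * phi s.
Proof. by rewrite cfunE sign_charE. Qed.

Lemma sign_char_lin : sign_char \is a linear_char.
Proof. by rewrite qualifE /= cfRepr_char cfRepr1 eqxx. Qed.

Definition sign_Iirr i := cfIirr (sign_char * 'chi_i).

Lemma sign_IirrE i : 'chi_(sign_Iirr i) = sign_char * 'chi_i.
Proof. by rewrite cfIirrE // mul_lin_irr ?sign_char_lin ?mem_irr. Qed.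

Lemma sign_IirrK : involutive sign_Iirr.
Proof.
move=> i; apply: irr_inj; rewrite !sign_IirrE; apply/cfunP=> x.
by rewrite !sign_char_mulE mulrA -signr_addb addbb mul1r.
Qed.

Lemma transp_eigenvalue_sign i : transp_eigenvalue (sign_Iirr i) = - transp_eigenvalue i.
Proof.
rewrite /transp_eigenvalue sign_IirrE -mulNr -sumrN; congr (_ / _).
  apply: eq_bigr => p lt; rewrite sign_char_mulE odd_tperm.
  by rewrite (_ : p.1 != p.2) ?mulN1r // neq_ltn lt.
by rewrite sign_char_mulE odd_perm1 mul1r.
Qed.

(* Twisting by the sign negates the eigenvalue, and it fixes every term because
   [s] and [r] have the parity of [t]. *)
Lemma rtw_prob_diff t s r : (1 < n)%N -> (0 < t)%N ->
  odd_perm s = odd t -> odd_perm r = odd t ->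
  ratr (rtw_prob t s - rtw_prob t r) * ((n`!)%:R * 'C(n, 2)%:R ^+ t) =
  (\sum_(i | 0 < transp_eigenvalue i)
     'chi_i 1%g * transp_eigenvalue i ^+ t * ('chi_i s - 'chi_i r)) *+ 2 :> algC.
Proof.
move=> n_gt1 t_gt0 os or.
rewrite rmorphB mulrBl !mulrA !rtw_prob_fourier // -sumrB.
pose F i := 'chi_i 1%g * transp_eigenvalue i ^+ t * ('chi_i s - 'chi_i r).
rewrite (eq_bigr F) => [|i _]; last by rewrite /F mulrBr.
rewrite (bigID (fun i => 0 < transp_eigenvalue i)) /= mulr2n; congr (_ + _).
rewrite (bigID (fun i => transp_eigenvalue i < 0)) /= [X in _ + X]big1 ?addr0.
  rewrite (reindex_inj (inv_inj sign_IirrK)) /=.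
  apply: eq_big => i.
    by rewrite transp_eigenvalue_sign oppr_gt0 oppr_lt0 andb_idl // => /ltW/le_gtF->.
  move=> _; rewrite /F transp_eigenvalue_sign sign_IirrE !sign_char_mulE os or odd_perm1 mul1r.
  rewrite -mulrBr [(- transp_eigenvalue i) ^+ t]exprNn -(signr_odd _ t) -!mulrA; congr (_ * _).
  by rewrite mulrCA signrMK.
move=> i /andP[n1 n2]; rewrite /F (_ : transp_eigenvalue i = 0) ?expr0n ?gtn_eqF ?mulr0 ?mul0r //.
have := real_ltgt0P (transp_eigenvalue_real i); case=> //; move: n1 n2.
  by move=> /negPf n1 _ p; rewrite p in n1.
by move=> _ /negPf n2 p; rewrite p in n2.
Qed.

(** [algC] is only partially ordered, so a sign can be read off a norm bound only for a real number;
    realness comes from the rational side of [rtw_prob_diff]. *)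
Lemma half_fourier_real t s r : (1 < n)%N -> (0 < t)%N ->
  odd_perm s = odd t -> odd_perm r = odd t ->
  \sum_(i | 0 < transp_eigenvalue i)
     'chi_i 1%g * transp_eigenvalue i ^+ t * ('chi_i s - 'chi_i r) \is Num.real.
Proof.
move=> n_gt1 t_gt0 os or; have e := rtw_prob_diff n_gt1 t_gt0 os or.
rewrite -[X in X \is _](mulfK (_ : 2%:R != 0)) ?pnatr_eq0 // mulr_natr -e.
rewrite rpredM ?rpredV ?realn // rpredM //; first exact: Creal_Crat (Crat_rat _).
by rewrite rpredM ?rpredX ?realn.
Qed.

Lemma rtw_prob_lt t s r : (1 < n)%N -> (0 < t)%N ->
  odd_perm s = odd t -> odd_perm r = odd t ->
  0 < \sum_(i | 0 < transp_eigenvalue i)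
        'chi_i 1%g * transp_eigenvalue i ^+ t * ('chi_i s - 'chi_i r) ->
  rtw_prob t r < rtw_prob t s.
Proof.
move=> n_gt1 t_gt0 os or pos; rewrite -subr_gt0 -(ltr_rat algC) rmorph0.
have posC : 0 < (n`!)%:R * 'C(n, 2)%:R ^+ t :> algC.
  by rewrite mulr_gt0 ?exprn_gt0 ?ltr0n ?fact_gt0 ?bin_gt0.
by rewrite -(pmulr_lgt0 _ posC) rtw_prob_diff // mulrn_wgt0.
Qed.

(** Conjugation extends the nonvanishing from the pair in [irr_depth_eigenvalue] to all disjoint
    pairs of the same sizes. The doubling and the summand [n] come from the ordered pairs and the
    diagonal in [trsum]. *)
Lemma irr_row_bound i : exists z,
  [/\ (z <= first_row i)%N, (z + first_row i <= n)%N,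
      forall B Z : {set 'I_n}, [disjoint B & Z] -> #|B| = first_row i -> #|Z| = z ->
        gsum_pair 'Chi_i B Z != 0 &
      transp_eigenvalue i *+ 2 + (n + 2 * (n - first_row i))%:R <=
      (first_row i ^ 2 + (n - first_row i) * z)%:R].
Proof.
have irr : mx_irreducible 'Chi_i by apply: socle_irr.
have [B [Z [dBZ leZB nzM maxB bnd]]] := irr_depth_eigenvalue irr (trsum_eigenvalue i).
have cB : #|B| = first_row i.
  apply/eqP; rewrite eqn_leq -gsum_irr_neq0; apply/andP; split.
    by apply: contraNneq nzM => ->; rewrite mul0mx.
  by apply/bigmax_leqP=> B' nzB'; rewrite leqNgt; apply: contra nzB' => /maxB->.
have cJ : #|~: B| = (n - first_row i)%N by rewrite cardsCs setCK cB card_ord.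
exists #|Z|; split; rewrite -?cB //.
- have := max_card [in Z :|: B]; rewrite cardsU disjoint_setI0 1?disjoint_sym // cards0 subn0 card_ord.
  by [].
- move=> B' Z' dBZ' cB' cZ'.
  exact: (gsum_pair_neq0_card dBZ dBZ' (esym cB') (esym cZ') nzM).
by move: bnd; rewrite cJ -cB -addrA -natrD.
Qed.

End Fourier.

(** * Numerical estimates *)

Section Numerics.
Local Open Scope nat_scope.

(** The three leading binomial terms of [(k + 1) ^ (m + 2)], doubled to clear the denominator. *)
Lemma expn_succ_lower k m :
  k ^ m * (2 * k ^ 2 + 2 * m.+2 * k + m.+2 * m.+1) <= 2 * k.+1 ^ m.+2.
Proof.
elim: m => [|m IH]; first by rewrite !expnS; nia.
rewrite [k.+1 ^ _]expnS mulnCA.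
apply: leq_trans (leq_mul (leqnn k.+1) IH).
rewrite expnS mulnA [k.+1 * _]mulnC -!mulnA [k * _]mulnC -!mulnA leq_mul2l.
by apply/orP; right; nia.
Qed.

(** Expanding [M ^ M] around [M - 1], the three leading terms are at least [1], [1] and [1 / 2]
    times [(M - 1) ^ M]. *)
Lemma expn_pred_self M : 0 < M -> 5 * M.-1 ^ M <= 2 * M ^ M.
Proof.
case: M => [//|[|k]] _ /=; first by rewrite exp1n.
apply: leq_trans (expn_succ_lower k.+1 k).
rewrite 2!expnS; set p := k.+1 ^ k; nia.
Qed.

(** Bernoulli's inequality [1 - D / M <= (1 - 1 / M) ^ D] with denominators cleared. *)
Lemma bernoulli_pred M D : D < M -> (M - D) * M ^ D <= M.-1 ^ D * M.
Proof.
elim: D => [|D IH] lt; first by rewrite subn0 !expn0; lia.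
have {}IH := IH (ltnW lt).
rewrite !expnS; set p := M ^ D in IH *; set q := M.-1 ^ D in IH *.
rewrite -[M.-1 * q * M]mulnA; apply: leq_trans (leq_mul (leqnn _) IH).
rewrite mulnA (mulnA M.-1) leq_mul2r; apply/orP; right.
by case: M lt {IH p q} => [//|M] lt /=; nia.
Qed.

(** Bernoulli reduces the claim to [D = 1], where [(1 - 1 / M) ^ (4 * M) <= (2 / 5) ^ 4 = 16 / 625 <
    1 / 32]. This is the origin of [32] and of the factor [4] in the time. *)
Lemma expn_decay M D t : D < M -> 4 * M <= t -> (M - D) ^ t * 32 ^ D <= M ^ t.
Proof.
move=> ltDM le4; have M_gt0 : 0 < M by lia.
have step : M.-1 ^ t * 32 <= M ^ t.
  have le32 : M.-1 ^ (4 * M) * 32 <= M ^ (4 * M).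
    have := expn_pred_self M_gt0; rewrite -(leq_exp2r _ _ (isT : 0 < 4)) !expnMn -!expnM.
    rewrite (_ : 5 ^ 4 = 625) // (_ : 2 ^ 4 = 16) // [4 * M]mulnC.
    move: (M.-1 ^ (M * 4)) (M ^ (M * 4)) => a b; lia.
  rewrite -(subnKC le4) (expnD M.-1 (4 * M)) (expnD M (4 * M)) mulnAC leq_mul //.
  by case: (t - 4 * M) => // k; rewrite leq_exp2r // leq_pred.
have MDt : 0 < (M ^ D) ^ t by rewrite !expn_gt0 M_gt0.
rewrite -(leq_pmul2r MDt) mulnAC -expnMn.
apply: leq_trans (leq_mul (_ : _ <= (M.-1 ^ D * M) ^ t) (leqnn _)) _.
  by case: t le4 {step MDt} => // t _; rewrite leq_exp2r // bernoulli_pred.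
rewrite expnMn mulnAC [X in _ <= X]mulnC leq_mul2r; apply/orP; right.
rewrite -!expnM ![D * t]mulnC !expnM -expnMn.
by case: D {ltDM MDt} => // D; rewrite leq_exp2r.
Qed.

Lemma bin_le_exp2 n m : 'C(n, m) <= 2 ^ n.
Proof.
elim: n m => [|n IH] [|m] //; first by rewrite bin0 expn_gt0.
by rewrite binS expnS mul2n -addnn leq_add.
Qed.

(** The shift [5] is the least possible, since [6 ^ 4 > 2 ^ 10]. *)
Lemma expn4_le_exp2 j : j ^ 4 <= 2 ^ (j + 5).
Proof.
have [lt6|] := ltnP j 6; first by case: j lt6 => [|[|[|[|[|[|]]]]]].
elim: j => [//|j IH]; rewrite leq_eqVlt => /predU1P[<-//|]; rewrite ltnS => le6.
rewrite addSn [2 ^ _]expnS; apply: leq_trans (leq_mul (leqnn 2) (IH le6)).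
rewrite !expnS expn0 !muln1.
have h1 : 6 * j <= j * j by rewrite leq_mul2r le6 orbT.
have h2 : 6 * (j * j) <= j * (j * j) by rewrite leq_mul2r le6 orbT.
have h3 : 6 * (j * (j * j)) <= j * (j * (j * j)) by rewrite leq_mul2r le6 orbT.
have -> : j.+1 * (j.+1 * (j.+1 * j.+1)) =
  j * (j * (j * j)) + 4 * (j * (j * j)) + 6 * (j * j) + 4 * j + 1 by ring.
lia.
Qed.

Lemma quadratic_le_exp32 i : 4 * i ^ 2 * i.+1 <= 32 ^ i.
Proof.
elim: i => [//|[//|i] IH]; rewrite [32 ^ _]expnS.
apply: leq_trans (leq_mul (leqnn 32) IH); rewrite !expnS expn0 !muln1; nia.
Qed.

(** * Inequalities for the cells, with [i] in the role of [m] and [g = n - 2 * m] *)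

Section Cells.
Variables (n i g a : nat).
Hypotheses (n_def : n = g + 2 * i) (g_gt0 : 0 < g) (i_gt0 : 0 < i).

(** The hook formula for two rows, with its denominator cleared. *)
Lemma two_row_degree j : 0 < j -> 2 * j <= n ->
  ('C(n, j) - 'C(n, j.-1)) * (n - j.-1) = 'C(n, j) * (n + 1 - 2 * j).
Proof.
case: j => [//|j] _ le /=; rewrite mulnBl [X in _ - X]mulnC -mul_bin_left.
rewrite [X in _ - X]mulnC -mulnBr; congr (_ * _); lia.
Qed.

Lemma bin_le_two_row_degree : 'C(n, i) <= ('C(n, i) - 'C(n, i.-1)) * i.+1.
Proof.
have e := @two_row_degree i i_gt0 (_ : 2 * i <= n); rewrite n_def leq_addl in e.
have {}e := e isT; rewrite -n_def in e.
have pos : 0 < n - i.-1 by lia.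
rewrite -(leq_pmul2r pos) mulnAC e -mulnA leq_mul2l; apply/orP; right.
by rewrite n_def; nia.
Qed.

(** Each unit of [k] gains [32 ^ i] and costs at most [4 * i ^ 2 * i.+1]: one [i] from the degrees,
    one from the character difference, and [i.+1] from comparing ['C(n, i)] with the leading
    degree. *)
Lemma cell_first_bound k : 0 < k ->
  'C(n, i) * i ^ k * i * 4 ^ k <= ('C(n, i) - 'C(n, i.-1)) * 32 ^ (i * k).
Proof.
move=> k_gt0; set d := _ - _.
apply: (@leq_trans (d * i.+1 * (i ^ k * i * 4 ^ k))).
  by rewrite -!mulnA (mulnA d) leq_mul // bin_le_two_row_degree.
rewrite -mulnA leq_mul2l; apply/orP; right.
rewrite expnM; apply: (@leq_trans ((4 * i ^ 2 * i.+1) ^ k)); last first.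
  by case: (k) => // k'; rewrite leq_exp2r // quadratic_le_exp32.
have h1 : i <= i ^ k by rewrite -{1}[i]expn1 leq_pexp2l.
have h2 : i.+1 <= i.+1 ^ k by rewrite -{1}[i.+1]expn1 leq_pexp2l.
rewrite !expnMn.
apply: leq_trans (leq_mul (leq_mul (leqnn (4 ^ k)) (leq_mul (leqnn (i ^ k)) h1)) h2).
by rewrite mulnC [_ * 4 ^ k]mulnC.
Qed.

(** Beyond [i] each step multiplies the binomial by at most [g + 1], so the degrees have ratio at
    most [2 * (g + 1) ^ l]; [2 ^ (g + 3)] bounds the difference of two character values. As
    [2 * l <= g], the exponent of [32] is at least [l * (g + 2)]. *)
Lemma cell_two_row_bound l : 0 < l -> 2 * l <= g ->
  2 ^ (g + 3) * ('C(n, i + l) - 'C(n, (i + l).-1)) * 64 ^ l <=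
  ('C(n, i) - 'C(n, i.-1)) * 32 ^ (2 * l * (g + 1 - l)).
Proof.
move=> l_gt0 le_lg; set d := _ - 'C(n, i.-1); set dj := _ - _.
have bin_le : 'C(n, i + l) <= 'C(n, i) * (g + 1) ^ l.
  elim: (l) le_lg => [|m IH] lem; first by rewrite addn0 expn0 muln1.
  have {}IH := IH (leq_trans (leq_mul (leqnn 2) (leqnSn m)) lem).
  rewrite addnS -(leq_pmul2l (ltn0Sn (i + m))) mul_bin_left [(g + 1) ^ _]expnS.
  apply: leq_trans (leq_mul (_ : _ <= (i + m).+1 * (g + 1)) IH) _.
    by rewrite n_def; nia.
  by apply: eq_leq; ring.
have ed := @two_row_degree i i_gt0; have edj := @two_row_degree (i + l).
have dj_le : dj <= 2 * (g + 1) ^ l * d.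
  have {}ed : d * (n - i.-1) = 'C(n, i) * (g + 1).
    by rewrite ed; [congr (_ * _)|]; lia.
  have {}edj : dj * (n - (i + l).-1) = 'C(n, i + l) * (n + 1 - 2 * (i + l)) by apply: edj; lia.
  have pos : 0 < n - (i + l).-1 by lia.
  rewrite -(leq_pmul2r pos) edj.
  apply: leq_trans (leq_mul bin_le (_ : _ <= g + 1)) _; first lia.
  rewrite mulnAC -ed.
  apply: leq_trans (_ : d * (2 * (n - (i + l).-1)) * (g + 1) ^ l <= _).
    by rewrite !leq_mul //; lia.
  by apply: eq_leq; ring.
apply: leq_trans (leq_mul (leq_mul (leqnn _) dj_le) (leqnn _)) _.
rewrite (_ : _ * _ * _ = d * (2 ^ (g + 3) * 2 * (g + 1) ^ l * 64 ^ l)); last by ring.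
rewrite leq_mul2l; apply/orP; right.
have le_g : (g + 1) ^ l <= 2 ^ (g * l).
  by rewrite expnM; case: (l) => // m; rewrite leq_exp2r // addn1 ltn_expl.
rewrite (_ : 64 = 2 ^ 6) // (_ : 32 = 2 ^ 5) // -!expnM -expnSr.
apply: leq_trans (leq_mul (leq_mul (leqnn _) le_g) (leqnn _)) _.
rewrite -!expnD leq_exp2l //.
have h1 : l * (g + 2) <= l * (2 * (g + 1 - l)) by rewrite leq_mul2l; apply/orP; right; lia.
have h2 : g <= l * g by rewrite leq_pmull.
rewrite (_ : 2 * l * (g + 1 - l) = l * (2 * (g + 1 - l))); last by ring.
by move: h1 h2; rewrite mulnDr [g * l]mulnC; lia.
Qed.

(** What remains of the exponents in [cell_general_bound] once [2 * l * l <= l * (g + k)] has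
    removed the negative part of [D]. *)
Lemma cell_exponent_bound l k : 0 < l -> 0 < k -> 9 <= n -> k <= i + l -> 2 * l <= g + k ->
  2 + 4 * g + 8 * i + 9 * k + l * k <= 10 * (l * g) + 8 * l + 9 * (i * k).
Proof.
move=> l_gt0 k_gt0 n9 lek le2l.
have lg_g : g <= l * g by rewrite leq_pmull.
have [k1|k2] := leqP k 1.
  by rewrite (_ : k = 1) ?muln1; lia.
have [le_l|lt_l] := leqP l (2 * i).
  have h : l * k <= 2 * (i * k) by rewrite mulnA leq_mul2r le_l orbT.
  have [i1|i2] := leqP i 1.
    by move: h le_l; rewrite (_ : i = 1) ?mul1n; lia.
  have h2 : 2 * i + 2 * k <= i * k + 4.
    by case: (i) i2 => [|[|i']] // _; case: (k) k2 => [|[|k']] // _; nia.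
  lia.
(* Here [2 * i < l <= g + i], so [i < g] and [k <= i + l <= 3 * g]. *)
have h : l * k <= 3 * (l * g) by rewrite mulnCA leq_mul2l; apply/orP; right; lia.
have h1 : k <= i * k by rewrite leq_pmull.
lia.
Qed.

Lemma cell_general_bound l k D : 0 < l -> 0 < k -> 9 <= n -> k <= i + l -> 2 * l <= g + k ->
  D + 2 * l * l = 2 * l * (g + 1) + (i + l) * k ->
  2 * ('C(n, i + l) * (i + l) ^ k) ^ 2 * 64 ^ l * 4 ^ k <= 32 ^ D.
Proof.
move=> l_gt0 k_gt0 n9 lek le2l eD; set j := i + l.
(* After squaring, [j] occurs as [j ^ 4], which [expn4_le_exp2] bounds without fractional
   exponents. *)
rewrite -(leq_exp2r _ _ (isT : 0 < 2)).
have -> : (2 * ('C(n, j) * j ^ k) ^ 2 * 64 ^ l * 4 ^ k) ^ 2 =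
          4 * 'C(n, j) ^ 4 * (j ^ 4) ^ k * 2 ^ (12 * l) * 2 ^ (4 * k).
  rewrite (expnM 2 12 l) (expnM 2 4 k) -(expnM j 4 k) [4 * k]mulnC (expnM j k 4).
  rewrite (_ : 2 ^ 12 = 64 ^ 2) // (_ : 2 ^ 4 = 4 ^ 2) // -!(expnM _ 2) ![2 * _]mulnC !(expnM _ _ 2).
  ring.
have hC : 'C(n, j) ^ 4 <= 2 ^ (n * 4) by rewrite expnM leq_exp2r // bin_le_exp2.
have hj : (j ^ 4) ^ k <= 2 ^ ((j + 5) * k).
  by rewrite expnM; case: (k) => // k'; rewrite leq_exp2r // expn4_le_exp2.
apply: leq_trans (leq_mul (leq_mul (leq_mul (leq_mul (leqnn 4) hC) hj) (leqnn _)) (leqnn _)) _.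
rewrite (_ : 4 * _ = 2 ^ (2 + n * 4)); last by rewrite expnD.
rewrite (_ : 32 = 2 ^ 5) // -!expnM -!expnD leq_exp2l //.
have := cell_exponent_bound l_gt0 k_gt0 n9 lek le2l.
have h : l * (2 * l) <= l * (g + k) by rewrite leq_mul2l le2l orbT.
rewrite n_def /j => hb; nia.
Qed.

End Cells.
End Numerics.

(** * Counting cycles and the points on them *)

Section CycleCounts.

Variable n : nat.
Implicit Types s r : {perm 'I_n}.
Local Notation cyc := cycles_of_length.
Local Open Scope nat_scope.

Lemma sum_cycles s (f : nat -> nat) :
  \sum_(O in porbits s) f #|O| = \sum_(0 <= k < n.+1) f k * #|cyc s k|.
Proof.
rewrite big_mkord (partition_big (fun O : {set 'I_n} => inord #|O| : 'I_n.+1) xpredT) //=.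
apply: eq_bigr => k _; rewrite mulnC -sum_nat_const.
have cO (O : {set 'I_n}) : (inord #|O| : 'I_n.+1) = #|O| :> nat.
  by rewrite inordK // ltnS; apply: leq_trans (max_card _) _; rewrite card_ord.
apply: eq_big => [O|O /andP[_ /eqP <-]]; last by rewrite cO.
by rewrite inE; congr (_ && _); rewrite -val_eqE /= cO.
Qed.

Lemma sum_card_porbits s : \sum_(O in porbits s) #|O| = n.
Proof.
rewrite -[RHS]card_ord -sum1_card (partition_big (porbit s) [in porbits s]) /=; last first.
  by move=> x _; apply: imset_f.
apply: eq_bigr => _ /imsetP[x _ ->]; rewrite -sum1_card; apply: eq_bigl => y.
by rewrite eq_porbit_mem.
Qed.

Lemma card_cycles0 s : #|cyc s 0| = 0.
Proof.
apply: eq_card0 => O; rewrite !inE; apply/negP => /andP[/imsetP[x _ ->]].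
by rewrite (negPf (card_porbit_neq0 s x)).
Qed.

(** [e] and [Y] count the cycles longer than [m] and the points on them. *)
Lemma cycle_counts s m : m <= n -> 0 < m ->
  exists e Y, [/\ #|porbits s| = \sum_(0 <= k < m) #|cyc s k| + (#|cyc s m| + e),
    n = \sum_(0 <= k < m) k * #|cyc s k| + (m * #|cyc s m| + Y), m.+1 * e <= Y & (e == 0) = (Y == 0)].
Proof.
move=> lemn m_gt0; exists (\sum_(m.+1 <= k < n.+1) #|cyc s k|), (\sum_(m.+1 <= k < n.+1) k * #|cyc s k|).
have split f : \sum_(0 <= k < n.+1) f k =
    \sum_(0 <= k < m) f k + (f m + \sum_(m.+1 <= k < n.+1) f k).
  by rewrite (big_cat_nat (n := m)) //= ?(leq_trans lemn) // [X in _ + X]big_ltn.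
split.
- rewrite -sum1_card (sum_cycles s (fun=> 1)) split !mul1n.
  by congr (_ + (_ + _)); apply: eq_bigr => k _; rewrite mul1n.
- by rewrite -{1}(sum_card_porbits s) (sum_cycles s id) split.
- rewrite big_distrr /= !big_nat; apply: leq_sum => k /andP[ltmk _].
  by rewrite leq_mul2r ltmk orbT.
rewrite !sum_nat_seq_eq0; apply: eq_in_all => k; rewrite mem_index_iota => /andP[ltmk _] /=.
by rewrite muln_eq0 (gtn_eqF (leq_ltn_trans (leq0n _) ltmk)).
Qed.

Lemma add_double_le_mul m q : 0 < m -> 1 < q -> q + 2 * m <= m * q + 2.
Proof.
by case: m q => [//|m] [|[|q]] // _ _; rewrite mulSn mulnSr mulnSr; lia.
Qed.

(** Off the common short cycles at least [2 * m] points remain, and [q] cycles of length at least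
    [m] on [X] of them satisfy [q <= X - 2 * m + 2]. Parity gives [2 * m < n]: for [n = 2 * m] the
    only possibility is two [m]-cycles against one [n]-cycle, of opposite signs. *)
Lemma cl_gt_cycles s r m : odd_perm s = odd_perm r ->
  (forall k, k < m -> #|cyc s k| = #|cyc r k|) -> #|cyc r m| < #|cyc s m| ->
  [/\ 0 < m, 2 * m < n, #|porbits s| <= n - 2 * m + 2 & #|porbits r| <= n - 2 * m + 2].
Proof.
move=> par eqc ltc.
have m_gt0 : 0 < m by rewrite lt0n; apply: contraTneq ltc => ->; rewrite !card_cycles0.
have lemn : m <= n.
  have : 0 < #|cyc s m| by lia.
  rewrite card_gt0 => /set0Pn[O]; rewrite inE => /andP[_ /eqP <-].
  by apply: leq_trans (max_card _) _; rewrite card_ord.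
have [es [Ys [ps ns les ees]]] := cycle_counts s lemn m_gt0.
have [er [Yr [pr nr ler eer]]] := cycle_counts r lemn m_gt0.
have eqA : \sum_(0 <= k < m) k * #|cyc s k| = \sum_(0 <= k < m) k * #|cyc r k|.
  by rewrite !big_nat; apply: eq_bigr => k /andP[_ /eqc ->].
have eqC : \sum_(0 <= k < m) #|cyc s k| = \sum_(0 <= k < m) #|cyc r k|.
  by rewrite !big_nat; apply: eq_bigr => k /andP[_ /eqc ->].
have leCA : \sum_(0 <= k < m) #|cyc r k| <= \sum_(0 <= k < m) k * #|cyc r k|.
  apply: leq_sum => k _; case: k => [|k]; first by rewrite card_cycles0.
  by rewrite leq_pmull.
rewrite eqA in ns; rewrite eqC in ps.
have parity : odd #|porbits s| = odd #|porbits r|.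
  by move: par; rewrite /odd_perm card_ord => /addbI.
rewrite ps pr in parity *.
move: ns nr leCA parity; set A := \sum_(0 <= k < m) k * _; set C := \sum_(0 <= k < m) _.
move: (#|cyc s m|) (#|cyc r m|) ltc => a b ltba ns nr leCA parity.
have eqX : m * a + Ys = m * b + Yr by lia.
have le2 : 2 * m <= m * a + Ys.
  have [a2|a1] := leqP 2 a; first by rewrite mulnC (leq_trans _ (leq_addr _ _)) // leq_mul2l a2 orbT.
  have [ea eb] : a = 1 /\ b = 0 by lia.
  rewrite ea eb muln1 muln0 add0n in eqX *.
  have : er != 0 by rewrite eer; lia.
  rewrite -lt0n => er0; have h := leq_mul (leqnn m.+1) er0.
  have : es != 0 by rewrite ees; lia.
  rewrite -lt0n => es0; have h' := leq_mul (leqnn m.+1) es0; lia.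
have bound c e Y : m * c + Y = m * a + Ys -> m.+1 * e <= Y -> c + e + 2 * m <= m * a + Ys + 2.
  move=> eY le; have : m * (c + e) <= m * a + Ys by rewrite mulnDr; lia.
  have [le2' _|lt2 le3] := leqP (c + e) 2; first lia.
  by apply: leq_trans (leq_add le3 (leqnn 2)); rewrite add_double_le_mul // ltnW.
have bs := bound _ _ _ erefl les; have br := bound _ _ _ (esym eqX) ler.
have lt2 : 2 * m < n.
  rewrite ltn_neqAle; apply/andP; split; last lia.
  apply/eqP => e2; have X2 : m * a + Ys = 2 * m by lia.
  have C0 : C = 0 by lia.
  have [a2|a1] := leqP 3 a.
    by have := leq_mul (leqnn m) a2; lia.
  have [ea|ea] : a = 2 \/ a = 1 by lia.
    have Y0 : Ys = 0 by rewrite ea in X2; lia.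
    have e0 : es = 0 by apply/eqP; rewrite ees Y0.
    have [eb|eb] : b = 1 \/ b = 0 by lia.
      have : er != 0 by rewrite eer; move: eqX; rewrite eb ea; lia.
      rewrite -lt0n => er0; have h := leq_mul (leqnn m.+1) er0.
      by move: eqX; rewrite eb ea; lia.
    have Yr2 : Yr = 2 * m by move: eqX; rewrite eb ea; lia.
    have : er != 0 by rewrite eer; lia.
    move: parity; rewrite C0 e0 ea eb.
    case: (er) ler => [|[|e]] //; rewrite Yr2 => h.
    by have := leq_mul (leqnn m.+1) (isT : 1 < e.+2); lia.
  have eb : b = 0 by lia.
  rewrite ea eb muln1 muln0 in X2 eqX.
  have : er != 0 by rewrite eer; lia.
  rewrite -lt0n => er0; have h := leq_mul (leqnn m.+1) er0.
  have : es != 0 by rewrite ees; lia.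
  by rewrite -lt0n => es0; have h' := leq_mul (leqnn m.+1) es0; lia.
split=> //; lia.
Qed.

End CycleCounts.

(** * From the real time bound to natural numbers *)

Section TimeBoundReal.
Import Rdefinitions Raxioms.

Lemma ln_nonneg (x : R) : (1 <= x)%R -> (0 <= Rpower.ln x)%R.
Proof.
case/RIneq.Rle_lt_or_eq_dec => [lt1|<-]; rewrite -{1}Rpower.ln_1; last exact: RIneq.Rle_refl.
by apply: RIneq.Rlt_le; apply: Rpower.ln_increasing lt1; Lra.lra.
Qed.

(** The first argument of the maximum is at least [4 * n ^ 2], because [4.14 > 4] and the
    logarithmic terms are nonnegative. *)
Lemma time_bound_INR n t : (INR 1 <= INR n)%R -> time_bound n t ->
  (INR 4 * (INR n * INR n) < INR t)%R.
Proof.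
rewrite /time_bound => N1 /(RIneq.Rle_lt_trans _ _ _ (Rbasic_fun.Rmax_l _ _)).
move: (INR n) (INR t) N1 => N T /= N1.
have two : (1 <= 1 + 1)%R by Lra.lra.
have p1 : (0 <= N * Rpower.ln N)%R.
  by apply: RIneq.Rmult_le_pos; [|apply: ln_nonneg]; Lra.lra.
have p2 : (0 <= Rpower.ln (1 + 1) * N)%R.
  by apply: RIneq.Rmult_le_pos; [apply: ln_nonneg|]; Lra.lra.
have p3 : (0 <= N * N)%R by apply: RIneq.Rmult_le_pos; Lra.lra.
have -> : (INR 414 / INR 100 = 4.14)%R by rewrite !RIneq.INR_IZR_INZ /=; Lra.lra.
Lra.lra.
Qed.

End TimeBoundReal.

Lemma time_bound_quadratic n t : (0 < n)%N -> time_bound n t -> (4 * n ^ 2 < t)%N.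
Proof.
move=> n_gt0 tb; apply/ssrnat.ltP/RIneq.INR_lt.
rewrite -mulnn -!multE !RIneq.mult_INR; apply: time_bound_INR tb.
by apply: (RIneq.le_INR 1 n); apply/ssrnat.leP.
Qed.

(** * Comparison with the leading character *)

Lemma geometric_sum_le N (x : algC) : 0 <= x -> x < 1 -> \sum_(l < N) x ^+ l <= (1 - x)^-1.
Proof.
move=> x_ge0 x_lt1; have pos : 0 < 1 - x by rewrite subr_gt0.
rewrite -(ler_pM2r pos) mulVf ?gt_eqF // mulrC -[1 - x]opprB mulNr -subrX1 opprB.
by rewrite gerBl exprn_ge0.
Qed.

Lemma cell_coordinates (n m y z l k : nat) :
  (z <= y)%N -> (z + y <= n)%N -> (m + y <= n)%N ->
  (n - y - m)%N = l -> (n - y - z)%N = k ->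
  [/\ y = (n - (m + l))%N, z = (m + l - k)%N, (m + l <= n)%N, (k <= m + l)%N &
      (m + l - k <= n - (m + l))%N].
Proof. by move=> *; split; lia. Qed.

Lemma leading_eigenvalue_gt0 (n m : nat) : (0 < m)%N -> (2 * m < n)%N -> (9 <= n)%N ->
  (2 * m + n < (n - m) ^ 2 + m ^ 2)%N.
Proof.
move=> m_gt0 lt2m n_ge9; pose g := (n - 2 * m)%N.
have -> : n = (g + 2 * m)%N by rewrite /g; lia.
have g_gt0 : (0 < g)%N by rewrite /g; lia.
have -> : (g + 2 * m - m = g + m)%N by lia.
have h1 : (g <= g * g)%N by rewrite leq_pmull.
rewrite -!mulnn mulnDr !mulnDl; have [m1|m2] := leqP m 1.
  have h2 : (2 * g <= g * g)%N by rewrite leq_mul2r; apply/orP; right; rewrite /g; lia.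
  by rewrite (_ : m = 1%N) ?muln1 ?mul1n; lia.
have h2 : (2 * m <= m * m)%N by rewrite leq_mul2r m2 orbT.
have h3 : (1 * m <= g * m)%N by rewrite leq_mul2r g_gt0 orbT.
lia.
Qed.

(** [M] is twice the leading eigenvalue and the first two summands are the bound of [irr_row_bound];
    [D] is the resulting drop. All is additive to avoid truncated subtraction. *)
Lemma eigenvalue_gap (n m l k D M : nat) : (2 * m < n)%N -> (m + l <= n)%N -> (k <= m + l)%N ->
  (M + 2 * m + n = (n - m) ^ 2 + m ^ 2)%N ->
  (D + 2 * l * l = 2 * l * (n - 2 * m + 1) + (m + l) * k)%N ->
  ((n - (m + l)) ^ 2 + (m + l) * (m + l - k) + D = M + (n + 2 * (m + l)))%N.
Proof.
move=> lt2m le_n le_k eM eD; apply/eqP; rewrite -(eqn_add2r (2 * l * l)) -addnA eD; apply/eqP.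
move: eM {eD}; have -> : (n - m = n - (m + l) + l)%N by lia.
have eg : (l * (n - 2 * m + m) = l * (n - (m + l) + l))%N.
  by rewrite (_ : (n - 2 * m + m = n - (m + l) + l)%N) //; lia.
have ev : ((m + l) * (m + l - k) + (m + l) * k = (m + l) * (m + l))%N.
  by rewrite -mulnDr subnK.
move: eg ev; move: (n - (m + l))%N (m + l - k)%N (n - 2 * m)%N => u v g; clear.
rewrite -!mulnn.
rewrite ![((m + l) * (m + l))%N]mulnDl !mulnDr !mulnDl; lia.
Qed.

Lemma two_shift_le (n m l k : nat) : (2 * m < n)%N -> (m + l <= n)%N ->
  (m + l - k <= n - (m + l))%N -> (2 * l <= n - 2 * m + k)%N.
Proof. lia. Qed.

Section Comparison.

Variables (n t m : nat) (s r : {perm 'I_n}).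
Local Notation G := [set: {perm 'I_n}]%G.
Local Notation cyc := cycles_of_length.
Implicit Types i : Iirr G.

Hypotheses (n_ge9 : (9 <= n)%N) (t_large : (4 * n ^ 2 <= t)%N).
Hypotheses (parity_s : odd_perm s = odd t) (parity_r : odd_perm r = odd t).
Hypothesis same_cycles : forall k, (k < m)%N -> #|cyc s k| = #|cyc r k|.
Hypothesis more_cycles : (#|cyc r m| < #|cyc s m|)%N.

Let counts := cl_gt_cycles (etrans parity_s (esym parity_r)) same_cycles more_cycles.
Let m_gt0 : (0 < m)%N. Proof. by case: counts. Qed.
Let lt2m : (2 * m < n)%N. Proof. by case: counts. Qed.
Let g := (n - 2 * m)%N.
Let a := (#|cyc s m| - #|cyc r m|)%N.
Let d := ('C(n, m) - 'C(n, m.-1))%N.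
Let M := ((n - m) ^ 2 + m ^ 2 - 2 * m - n)%N.
Let w i := transp_eigenvalue i.

Let n_def : n = (g + 2 * m)%N. Proof. rewrite /g; lia. Qed.
Let g_gt0 : (0 < g)%N. Proof. rewrite /g; lia. Qed.
Let a_gt0 : (0 < a)%N. Proof. by rewrite subn_gt0. Qed.

Let lead_gt0 := leading_eigenvalue_gt0 m_gt0 lt2m n_ge9.

Let M_def : (M + 2 * m + n = (n - m) ^ 2 + m ^ 2)%N.
Proof. by rewrite /M -subnDA -addnA subnK // ltnW. Qed.

Let M_gt0 : (0 < M)%N.
Proof. by rewrite /M -subnDA subn_gt0. Qed.

Let M_le_t : (4 * M <= t)%N.
Proof.
apply: leq_trans t_large; rewrite leq_mul2l /= /M -subnDA.
apply: leq_trans (leq_subr _ _) _.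
have -> : n = (n - m + m)%N by lia.
by rewrite addnK sqrnD leq_addr.
Qed.

Lemma leading_character : exists i0,
  [/\ 'chi_i0 = two_row_char _ m, 'chi_i0 1%g = d%:R, 'chi_i0 s - 'chi_i0 r = a%:R &
      w i0 *+ 2 = M%:R].
Proof.
have le2m : (2 * m <= #|'I_n|)%N by rewrite card_ord ltnW.
have [i0 e0] := two_row_irr le2m; exists i0.
have diff : 'chi_i0 s - 'chi_i0 r = a%:R.
  have lem : (m <= #|'I_n|)%N by apply: leq_trans le2m; rewrite leq_pmull.
  rewrite e0 two_row_charE // !cfunE.
  have -> : set_char _ m.-1 s = set_char _ m.-1 r.
    apply: (Ind1_eq_small_cycles same_cycles).
    by rewrite setCK card_initial_set ?prednK // (leq_trans (leq_pred m)).
  have := Ind1_diff_small_cycles same_cycles (B := ~: initial_set _ m).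
  rewrite setCK card_initial_set // => /(_ erefl) eqd.
  rewrite opprD opprK addrACA addNr addr0 /a natrB ?eqd // ltnW //.
have le_bin : ('C(n, m.-1) <= 'C(n, m))%N.
  have := @leq_bin_pred 'I_n m.-1; rewrite prednK // card_ord; apply; exact: ltnW.
split=> //.
  rewrite e0 two_row_charE // !cfunE !set_char1 ?card_ord ?natrB //; lia.
have [lef nz] := two_row_first_row le2m e0.
(* A longer first row would force equal values at [s] and [r], but they differ by [a > 0]. *)
have fi : first_row i0 = (#|'I_n| - m)%N.
  apply/eqP; rewrite eqn_leq lef andbT leqNgt; apply/negP => lt.
  have eq0 : 'chi_i0 s = 'chi_i0 r.
    apply: (irr_eq_small_cycles same_cycles); rewrite card_ord in lt *.
    by move: lt; rewrite ltn_subLR // ltnW // (leq_trans _ lt2m) // ltnS leq_pmull.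
  by move: diff; rewrite eq0 subrr => /esym/eqP; rewrite pnatr_eq0 gtn_eqF.
have := two_row_eigenvalue le2m fi nz (trsum_eigenvalue i0).
by rewrite card_ord -M_def !natrD [LHS]addrAC => /addIr/addIr.
Qed.

Variable i0 : Iirr G.
Hypotheses (i0_two_row : 'chi_i0 = two_row_char _ m) (i0_degree : 'chi_i0 1%g = d%:R).
Hypotheses (i0_diff : 'chi_i0 s - 'chi_i0 r = a%:R) (i0_eigenvalue : w i0 *+ 2 = M%:R).

Let w0 := w i0.

Let w0_gt0 : 0 < w0.
Proof. by rewrite -(pmulrn_lgt0 _ (isT : (0 < 2)%N)) i0_eigenvalue ltr0n. Qed.

Lemma decay_exponent l k : (2 * l <= g + k)%N ->
  exists D, (D + 2 * l * l = 2 * l * (g + 1) + (m + l) * k)%N.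
Proof.
move=> le_2l; exists (2 * l * (g + 1) + (m + l) * k - 2 * l * l)%N.
have h1 : (l * (2 * l) <= l * (g + k))%N by rewrite leq_mul2l le_2l orbT.
rewrite subnK //; apply: leq_trans (_ : l * (g + k) <= _)%N; first by rewrite mulnC.
rewrite mulnDr leq_add //; last by rewrite leq_mul2r leq_addl orbT.
by rewrite [(2 * l)%N]mulnC -mulnA leq_mul2l; apply/orP; right; lia.
Qed.

Lemma eigenvalue_decay i l k D : 0 < w i -> (m + l <= n)%N -> (k <= m + l)%N ->
  (D + 2 * l * l = 2 * l * (g + 1) + (m + l) * k)%N ->
  w i *+ 2 + (n + 2 * (m + l))%:R <= ((n - (m + l)) ^ 2 + (m + l) * (m + l - k))%:R ->
  w i ^+ t * 32%:R ^+ D <= w0 ^+ t.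
Proof.
move=> wi_gt0 le_n le_k eD bnd.
have eqMD := eigenvalue_gap lt2m le_n le_k M_def eD.
have le_wM : w i *+ 2 + D%:R <= M%:R.
  have := lerD bnd (lexx (D%:R : algC)).
  by rewrite -[leRHS]natrD eqMD [leRHS]natrD addrAC lerD2r.
(* Positivity of [w i] makes this strict, so [M - D] is not truncated. *)
have ltDM : (D < M)%N.
  by rewrite -(ltr_nat algC); apply: lt_le_trans le_wM; rewrite ltrDr pmulrn_lgt0.
have le_w : w i *+ 2 <= (M - D)%:R by rewrite natrB ?(ltnW ltDM) // lerBrDr.
have := expn_decay ltDM M_le_t; rewrite -(ler_nat algC) natrM !natrX -i0_eigenvalue.
have := lerXn2r t _ _ le_w; rewrite !nnegrE ler0n mulrn_wge0 ?(ltW wi_gt0) // => /(_ isT isT) le1 le2.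
have pos2 : 0 < (2%:R : algC) ^+ t by rewrite exprn_gt0 ?ltr0n.
rewrite -(ler_pM2r pos2) mulrAC -!exprMn !mulr_natr; apply: le_trans le2.
by rewrite ler_pM2r ?exprn_gt0 ?ltr0n // natrX in le1 *.
Qed.

Let A := d%:R * a%:R * w0 ^+ t.
Let F i := 'chi_i 1%g * w i ^+ t * `|'chi_i s - 'chi_i r|.

Let cyc_diff : `|#|cyc s m|%:R - #|cyc r m|%:R| = a%:R :> algC.
Proof. by rewrite -natrB ?normr_nat // ltnW. Qed.

Let d_gt0 : (0 < d)%N.
Proof. by rewrite -(ltr_nat algC) -i0_degree irr1_gt0. Qed.

Section Cell.

Variables (P : pred (Iirr G)) (l k : nat).
Hypotheses (l_le : (m + l <= n)%N) (k_le : (k <= m + l)%N) (z_le : (m + l - k <= n - (m + l))%N).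
Hypothesis P_pos : forall i, P i -> 0 < w i.
Hypothesis P_row : forall i, P i -> first_row i = (n - (m + l))%N.
Hypothesis P_pair : forall i, P i -> forall B Z : {set 'I_n}, [disjoint B & Z] ->
  #|B| = first_row i -> #|Z| = (m + l - k)%N -> gsum_pair 'Chi_i B Z != 0.
Hypothesis P_bound : forall i, P i ->
  w i *+ 2 + (n + 2 * (m + l))%:R <= ((n - (m + l)) ^ 2 + (m + l) * (m + l - k))%:R.

Let le_2l : (2 * l <= g + k)%N. Proof. exact: two_shift_le. Qed.

(** The factor [32 ^- D] is common to the cell, so it suffices to bound the degrees weighted by the
    character differences by some [X] and to compare natural numbers. *)
Lemma cell_sum_le D (X : nat) : (D + 2 * l * l = 2 * l * (g + 1) + (m + l) * k)%N ->
  \sum_(i | P i) 'chi_i 1%g * `|'chi_i s - 'chi_i r| <= X%:R ->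
  (X * 64 ^ l * 4 ^ k <= d * a * 32 ^ D)%N ->
  (\sum_(i | P i) F i) * (64%:R ^+ l * 4%:R ^+ k) <= A.
Proof.
move=> eD leX leXd; have pos : 0 < (32%:R : algC) ^+ D by rewrite exprn_gt0 ?ltr0n.
rewrite -(ler_pM2r pos); apply: le_trans (_ : w0 ^+ t * X%:R * (64%:R ^+ l * 4%:R ^+ k) <= _).
  rewrite mulrAC ler_pM2r ?mulr_gt0 ?exprn_gt0 ?ltr0n //.
  apply: le_trans (_ : w0 ^+ t * (\sum_(i | P i) 'chi_i 1%g * `|'chi_i s - 'chi_i r|) <= _).
    rewrite mulr_suml mulr_sumr; apply: ler_sum => i Pi.
    have := eigenvalue_decay (P_pos Pi) l_le k_le eD (P_bound Pi) => le_w.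
    rewrite /F [leLHS](_ : _ = w i ^+ t * 32%:R ^+ D * ('chi_i 1%g * `|'chi_i s - 'chi_i r|)); last by ring.
    by rewrite ler_wpM2r // mulr_ge0 // ltW ?irr1_gt0.
  by rewrite ler_wpM2l // exprn_ge0 // ltW.
rewrite /A [leLHS](_ : _ = w0 ^+ t * (X * 64 ^ l * 4 ^ k)%:R); last by rewrite !natrM !natrX; ring.
rewrite [leRHS](_ : _ = w0 ^+ t * (d * a * 32 ^ D)%:R); last by rewrite !natrM !natrX; ring.
by rewrite ler_wpM2l ?exprn_ge0 ?(ltW w0_gt0) // ler_nat.
Qed.

Let degree_sum : \sum_(i | P i) 'chi_i 1%g <= ('C(n, m + l) * (m + l) ^ k)%:R.
Proof.
pose J := initial_set 'I_n (m + l); pose Z := initial_set 'I_n (m + l - k).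
have cJ : #|J| = (m + l)%N by rewrite card_initial_set ?card_ord.
have cZ : #|Z| = (m + l - k)%N.
  by rewrite card_initial_set // card_ord (leq_trans (leq_subr _ _)).
have cB : #|~: J| = (n - (m + l))%N by rewrite cardsCs setCK cJ card_ord.
have dJZ : [disjoint ~: J & Z].
  rewrite disjoints_subset setCS; apply/subsetP=> x; rewrite !inE.
  by rewrite -(take_takel _ (leq_subr k (m + l))) => /mem_take.
have := @sum_degree_gsum_pair 'I_n P (m + l) (m + l - k) (~: J) Z.
rewrite card_ord subKn //; apply=> //; first exact: leq_subr.
by move=> i Pi; apply: P_pair; rewrite ?P_row.
Qed.

Lemma first_cell_sum : l = 0%N -> (0 < k)%N ->
  (\sum_(i | P i) F i) * (64%:R ^+ l * 4%:R ^+ k) <= A.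
Proof.
move=> l0 k_gt0; have [D eD] := decay_exponent le_2l.
apply: (cell_sum_le (X := 'C(n, m) * m ^ k * m * a) eD).
  apply: le_trans (_ : (\sum_(i | P i) 'chi_i 1%g) * (m * a)%:R <= _).
    rewrite mulr_suml; apply: ler_sum => i Pi; rewrite ler_wpM2l ?(ltW (irr1_gt0 _)) //.
    rewrite natrM -cyc_diff; apply: (irr_diff_small_cycles same_cycles).
    by rewrite card_ord P_row // l0 addn0 subnKC // ltnW // (leq_trans _ lt2m) // ltnS leq_pmull.
  have := degree_sum; rewrite l0 addn0 => le; rewrite -mulnA [leRHS]natrM.
  by rewrite ler_wpM2r ?ler0n.
have := cell_first_bound n_def g_gt0 m_gt0 k_gt0; rewrite -/d => le.
move: eD; rewrite l0 !muln0 !addn0 mul0n add0n expn0 muln1 => ->.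
by apply: leq_trans (leq_trans (leq_mul le (leqnn a)) _); apply: eq_leq; ring.
Qed.

Lemma two_row_cell_sum : (0 < l)%N -> k = 0%N ->
  (\sum_(i | P i) F i) * (64%:R ^+ l * 4%:R ^+ k) <= A.
Proof.
move=> l_gt0 k0; have [D eD] := decay_exponent le_2l.
have le_2j : (2 * (m + l) <= #|'I_n|)%N by rewrite card_ord mul2n -addnn -leq_subRL //; move: z_le; rewrite k0 subn0.
have le_2lg : (2 * l <= g)%N by move: le_2l; rewrite k0 addn0.
(* For [k = 0] the set [Z] fills the complement of [B], so the cell contains at most one character,
   the two-row one. *)
have Ptr i : P i -> 'chi_i = two_row_char _ (m + l).
  move=> Pi; apply: irr_two_row => //; first by rewrite P_row ?card_ord.
  have cJ : #|initial_set 'I_n (m + l)| = (m + l)%N by rewrite card_initial_set ?card_ord.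
  rewrite -gsum_setstab_neq0; apply: (P_pair Pi).
  - by rewrite -setI_eq0 setICr.
  - by rewrite cardsCs setCK cJ card_ord P_row.
  - by rewrite setCK cJ k0 subn0.
have bound_p (u : {perm 'I_n}) : (#|porbits u| <= g + 2)%N -> `|two_row_char _ (m + l) u| <= (2 ^ (g + 2))%:R.
  move=> le; apply: le_trans (two_row_char_bound _ _) _; last by rewrite ler_nat leq_exp2l.
  by rewrite card_ord.
have [_ _ ps pr] := counts.
apply: (cell_sum_le (X := 2 ^ (g + 3) * ('C(n, m + l) - 'C(n, (m + l).-1))) eD).
  have [i1 Pi1|P0] := pickP P; last by rewrite big_pred0 // ler0n.
  rewrite (big_pred1 i1) => [|i]; last first.
    apply/idP/eqP => [Pi|->//]; apply: irr_inj; by rewrite !Ptr.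
  rewrite Ptr // mulrC natrM; apply: ler_pM => //.
  - by rewrite -(Ptr i1) // ltW ?irr1_gt0.
  - apply: le_trans (ler_normB _ _) _; rewrite addnS expnS mul2n -addnn natrD.
    by rewrite lerD ?bound_p.
  rewrite two_row_charE ?addn_gt0 ?m_gt0 // !cfunE !set_char1 ?card_ord //; last first.
    by rewrite (leq_trans (leq_pred _)).
  by rewrite lerBlDl -natrD ler_nat -leq_subLR.
have := cell_two_row_bound n_def g_gt0 m_gt0 l_gt0 le_2lg; rewrite -/d k0 expn0 muln1.
have -> : (2 * l * (g + 1 - l))%N = D by move: eD; rewrite k0 muln0 addn0 mulnBr => <-; rewrite addnK.
move=> le; apply: leq_trans le _; rewrite leq_mul2r; apply/orP; right.
by rewrite leq_pmulr.
Qed.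

Lemma general_cell_sum : (0 < l)%N -> (0 < k)%N ->
  (\sum_(i | P i) F i) * (64%:R ^+ l * 4%:R ^+ k) <= A.
Proof.
move=> l_gt0 k_gt0; have [D eD] := decay_exponent le_2l.
apply: (cell_sum_le (X := 2 * ('C(n, m + l) * (m + l) ^ k) ^ 2) eD).
  have le_deg := degree_sum; set S := \sum_(i | P i) 'chi_i 1%g in le_deg *.
  have S_ge0 : 0 <= S by apply: sumr_ge0 => i _; rewrite ltW ?irr1_gt0.
  apply: le_trans (_ : S * (2%:R * S) <= _).
    rewrite mulr_suml; apply: ler_sum => i Pi; rewrite ler_wpM2l ?(ltW (irr1_gt0 _)) //.
    apply: le_trans (ler_normB _ _) _; rewrite mulr_natl mulr2n.
    have le_S : 'chi_i 1%g <= S.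
      rewrite /S (bigD1 i) //= lerDl; apply: sumr_ge0 => j _.
      by rewrite ltW ?irr1_gt0.
    by rewrite lerD // (le_trans _ le_S) // char1_ge_norm ?irr_char.
  rewrite mulrCA natrM natrX ler_wpM2l ?ler0n // expr2.
  by apply: ler_pM.
apply: leq_trans (cell_general_bound n_def g_gt0 m_gt0 l_gt0 k_gt0 n_ge9 k_le le_2l eD) _.
by rewrite leq_pmull // muln_gt0 d_gt0.
Qed.

End Cell.

Let A_gt0 : 0 < A.
Proof. by rewrite !mulr_gt0 ?exprn_gt0 ?ltr0n. Qed.

(** With cell [(0, 0)] included, the weights sum to at most [64 / 63 * (4 / 3) = 256 / 189 < 2];
    that cell accounts for [1]. *)
Lemma sum_nonzero_cells_lt N (c : 'I_N.+1 * 'I_N.+1 -> algC) :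
  c (ord0, ord0) = 0 ->
  (forall p, p != (ord0, ord0) -> c p * (64%:R ^+ p.1 * 4%:R ^+ p.2) <= A) ->
  \sum_p c p < A.
Proof.
move=> c0 cA; pose x : algC := 64%:R^-1; pose y : algC := 4%:R^-1.
have le_c p : p != (ord0, ord0) -> c p <= A * (x ^+ p.1 * y ^+ p.2).
  move=> np.
  have pos : 0 < 64%:R ^+ p.1 * 4%:R ^+ p.2 :> algC by rewrite mulr_gt0 ?exprn_gt0 ?ltr0n.
  by rewrite /x /y !exprVn -invfM ler_pdivlMr // cA.
have sum_xy : \sum_(p : 'I_N.+1 * 'I_N.+1) x ^+ p.1 * y ^+ p.2 < 2%:R.
  rewrite -(pair_bigA _ (fun u v : 'I_N.+1 => x ^+ u * y ^+ v)) /= -big_distrlr /=.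
  have x_ge0 : 0 <= x by rewrite invr_ge0 ler0n.
  have y_ge0 : 0 <= y by rewrite invr_ge0 ler0n.
  have x_lt1 : x < 1 by rewrite invf_lt1 ?ltr0n // ltr1n.
  have y_lt1 : y < 1 by rewrite invf_lt1 ?ltr0n // ltr1n.
  apply: le_lt_trans (_ : (1 - x)^-1 * (1 - y)^-1 < _).
    by apply: ler_pM; rewrite ?geometric_sum_le ?sumr_ge0 // => i _; rewrite exprn_ge0.
  have -> : (1 - x)^-1 * (1 - y)^-1 = 256%:R / 189%:R.
    rewrite /x /y (_ : 1 - 64%:R^-1 = 63%:R / 64%:R); last by field.
    by rewrite (_ : 1 - 4%:R^-1 = 3%:R / 4%:R); field.
  by rewrite ltr_pdivrMr ?ltr0n // -natrM ltr_nat.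
rewrite (bigD1 (ord0, ord0)) //= c0 add0r.
apply: le_lt_trans (ler_sum _ (fun p np => le_c p np)) _.
rewrite -mulr_sumr gtr_pMr // -(ltrD2l 1) (_ : 1 + 1 = 2%:R) //.
by rewrite (bigD1 (ord0, ord0)) //= !expr0 mulr1 in sum_xy.
Qed.

Lemma rtw_prob_comparison : rtw_prob t r < rtw_prob t s.
Proof.
have n_gt1 : (1 < n)%N by apply: leq_trans n_ge9.
have t_gt0 : (0 < t)%N by apply: leq_trans t_large; rewrite muln_gt0 expn_gt0 (ltnW n_gt1).
apply: rtw_prob_lt => //; have := half_fourier_real n_gt1 t_gt0 parity_s parity_r.
rewrite (bigD1 i0) /=; last exact: w0_gt0.
have -> : 'chi_i0 1%g * transp_eigenvalue i0 ^+ t * ('chi_i0 s - 'chi_i0 r) = A.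
  by rewrite i0_degree i0_diff /A mulrAC.
set S := \sum_(i | _) _ => S_real.
have {}S_real : S \is Num.real.
  by rewrite -(addKr A S) rpredD // rpredN realE ltW.
suff : `|S| < A 
  by rewrite real_ltr_norml // => /andP[lt _]; rewrite -(opprK S) subr_gt0 ltrNl.
have /fin_all_exists[z zP] i := @irr_row_bound n i.
pose Q i := [&& 0 < w i, i != i0 & (m + first_row i <= n)%N].
have le_S : `|S| <= \sum_(i | Q i) F i.
  rewrite /S (bigID (fun i => (m + first_row i <= n)%N)) /= [X in _ + X]big1 ?addr0.
    apply: le_trans (ler_norm_sum _ _ _) _; rewrite le_eqVlt; apply/orP; left; apply/eqP.
    apply: eq_big => [i|i /andP[/andP[wi _] _]]; first by rewrite /Q andbA.
    by rewrite normrM ger0_norm // mulr_ge0 ?exprn_ge0 // ltW ?irr1_gt0.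
  move=> i /andP[_ lt]; rewrite (irr_eq_small_cycles same_cycles (i := i)) ?subrr ?mulr0 //.
  by rewrite card_ord ltnNge.
apply: le_lt_trans le_S _.
pose lk i : 'I_n.+1 * 'I_n.+1 := (inord (n - first_row i - m), inord (n - first_row i - z i)).
have lkE i l k : lk i = (l, k) -> (n - first_row i - m = l)%N /\ (n - first_row i - z i = k)%N.
  by case=> <- <-; rewrite !inordK // ltnS ?(leq_trans (leq_subr _ _)) ?leq_subr.
rewrite (partition_big lk xpredT) //=; apply: sum_nonzero_cells_lt => [|[l k] nlk].
  (* Only the two-row character of [m] could lie in cell [(0, 0)], and this is [i0], already split
     off. *)
  apply: big_pred0 => i; apply/negP => /andP[/and3P[wi ni0 le_mi] /eqP/lkE[/= el ek]].
  case/negP: ni0; apply/eqP/irr_inj; rewrite i0_two_row.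
  have [le_z le_zn pz _] := zP i.
  have [fi ez le_m0 _ _] := cell_coordinates le_z le_zn le_mi el ek.
  rewrite addn0 in fi le_m0; rewrite addn0 subn0 in ez.
  have cJ : #|initial_set 'I_n m| = m by rewrite card_initial_set // card_ord.
  apply: irr_two_row; [by rewrite card_ord ltnW | by rewrite card_ord | ].
  rewrite -gsum_setstab_neq0; apply: pz.
  - by rewrite -setI_eq0 setICr.
  - by rewrite cardsCs setCK cJ card_ord fi.
  - by rewrite setCK cJ.
have [i1 /andP[/and3P[_ _ le_mi1] /eqP/lkE[el1 ek1]]|P0] := pickP (fun i => Q i && (lk i == (l, k))); last first.
  by rewrite big_pred0 // mul0r ltW.
have [le_z1 le_zn1 _ _] := zP i1.
have [_ _ H1 H2 H3] := cell_coordinates le_z1 le_zn1 le_mi1 el1 ek1.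
have PE i : Q i && (lk i == (l, k)) -> first_row i = (n - (m + l))%N /\ z i = (m + l - k)%N.
  move=> /andP[/and3P[_ _ le_mi] /eqP/lkE[el ek]]; have [le_z le_zn _ _] := zP i.
  by have [] := cell_coordinates le_z le_zn le_mi el ek.
have P1 i : Q i && (lk i == (l, k)) -> 0 < w i by case/andP=> /and3P[].
have P2 i : Q i && (lk i == (l, k)) -> first_row i = (n - (m + l))%N by case/PE.
have P3 i : Q i && (lk i == (l, k)) -> forall B Z : {set 'I_n}, [disjoint B & Z] ->
    #|B| = first_row i -> #|Z| = (m + l - k)%N -> gsum_pair 'Chi_i B Z != 0.
  by move=> /PE[_ <-]; have [_ _ pz _] := zP i.
have P4 i : Q i && (lk i == (l, k)) -> w i *+ 2 + (n + 2 * (m + l))%:R <=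
    ((n - (m + l)) ^ 2 + (m + l) * (m + l - k))%:R.
  by move=> /PE[ef ez]; have [_ _ _] := zP i; rewrite ez ef subKn.
have [l0|l_gt0] := posnP (l : nat); have [k0|k_gt0] := posnP (k : nat).
- by case/negP: nlk; rewrite xpair_eqE -!val_eqE /= l0 k0.
- exact: first_cell_sum P1 P2 P3 P4 l0 k_gt0.
- exact: two_row_cell_sum P1 P2 P3 P4 l_gt0 k0.
- exact: general_cell_sum P1 P2 P3 P4 l_gt0 k_gt0.
Qed.

End Comparison.

(* Conjugacy classes are represented by elements s, r; P^{*t} is a class function.
   alpha >_CL beta already forces alpha <> beta. *)
Theorem theorem5p12 (n t : nat) (s r : {perm 'I_n}) :
  (9 <= n)%N -> time_bound n t ->
  odd_perm s = odd t -> odd_perm r = odd t ->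
  cl_gt s r ->
  (rtw_prob t r < rtw_prob t s)%R.
Proof.
move=> n_ge9 /(time_bound_quadratic (leq_trans (ltn0Sn 8) n_ge9))/ltnW t_large.
move=> parity_s parity_r [m [same_cycles more_cycles]].
have [i0 [e0 deg diff eig]] :=
  leading_character n_ge9 t_large parity_s parity_r same_cycles more_cycles.
exact: (rtw_prob_comparison n_ge9 t_large parity_s parity_r same_cycles more_cycles
  e0 deg diff eig).
Qed.
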